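(* Let $T\subset\mathbb{R}^d$ be compact and let $f:T\to\mathbb{R}$ be a mean zero Gaussian random field satisfying conditions (B1) and (B2) of the context, whose global maximum over $T$ is almost surely attained at a single point. If $\theta\in(0,1)$ then, as $b\to\infty$, $$\sup_{\#(\widetilde T)\le b^{\theta d}}P\Big(\sup_{t\in\widetilde T}f(t)>b\ \Big|\ \sup_{t\in T}f(t)>b\Big)\to0,$$ where the outer supremum is over finite subsets $\widetilde T\subset T$ of cardinality at most $b^{\theta d}$.
   Context: Notation. $|x|=\sum_{j=1}^d|x_j|$; $m$ is Lebesgue measure; $B(t,\varepsilon)=\{s:|t-s|\le\varepsilon\}$; $\#$ denotes cardinality; $\operatorname{Var}(f(t))>0$. (B1) $f$ is homogeneous (its law is invariant under translations) and almost surely twice continuously differentiable. (B2) $0\in T\subset\mathbb{R}^d$ is a $d$-dimensional convex set with nonempty interior; its boundary $\partial T$ is a $(d-1)$-dimensional manifold without boundary; and there exists $\kappa_0>0$ with $m(B(t,\varepsilon)\cap T)\ge\kappa_0\varepsilon^d$ for all $t\in T$ and $\varepsilon<1$. *)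

(* Defs.v *)
From HB Require Import structures.
From mathcomp Require Import all_boot all_order all_algebra finmap.
From mathcomp Require Import all_classical all_reals all_analysis.

Set Implicit Arguments.
Unset Strict Implicit.
Unset Printing Implicit Defensive.

Import Order.TTheory GRing.Theory Num.Theory.
Import numFieldNormedType.Exports.

Local Open Scope classical_set_scope.
Local Open Scope ring_scope.

Definition norm1 (R : realType) (d : nat) (x : 'rV[R]_d) : R :=
  \sum_(j < d) `|x ord0 j|.

(* The library's norm on ['rV[R]_d] is the sup norm, hence the separate ball. *)
Definition ball1 (R : realType) (d : nat) (t : 'rV[R]_d) (e : R) :
    set 'rV[R]_d :=
  [set s | norm1 (t - s) <= e].

Definition box (R : realType) (d : nat) (a b : 'rV[R]_d) : set 'rV[R]_d :=
  [set x | forall i, a ord0 i <= x ord0 i <= b ord0 i].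

Definition box_volume (R : realType) (d : nat) (a b : 'rV[R]_d) : R :=
  \prod_(i < d) Num.max 0 (b ord0 i - a ord0 i).

(* [0 < d]: Lebesgue (outer) measure on R^d, i.e. the infimum of the total
   volumes of countable covers by boxes. *)
Definition lebesgue_rV (R : realType) (d : nat) (A : set 'rV[R]_d) : \bar R :=
  ereal_inf
    [set (\sum_(k <oo) (box_volume (c k).1 (c k).2)%:E)%E
      | c in [set c : nat -> 'rV[R]_d * 'rV[R]_d
                | A `<=` \bigcup_k box (c k).1 (c k).2]].

Definition boundary (X : topologicalType) (A : set X) : set X :=
  closure A `\` interior A.

Definition homeomorphic_sets (X Y : topologicalType) (A : set X) (B : set Y) :
    Prop :=
  exists (phi : X -> Y) (psi : Y -> X),
    [/\ {within A, continuous phi}, {within B, continuous psi},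
        (forall x, A x -> B (phi x) /\ psi (phi x) = x)
      & (forall y, B y -> A (psi y) /\ phi (psi y) = y)].

(* [M] is a topological k-manifold without boundary for the subspace topology:
   charts take values in open subsets of R^k.  The Hausdorff and
   second-countability axioms are automatic for subsets of R^d. *)
Definition manifold_without_boundary (R : realType) (d k : nat)
    (M : set 'rV[R]_d) : Prop :=
  forall x, M x ->
    exists (U : set 'rV[R]_d) (V : set 'rV[R]_k),
      [/\ open U, U x, open V & homeomorphic_sets (M `&` U) V].

Definition condition_B2 (R : realType) (d : nat) (T : set 'rV[R]_d) : Prop :=
  [/\ T 0,
      convex_set (T : set (convex_lmodType 'rV[R]_d)),
      interior T !=set0,
      manifold_without_boundary d.-1 (boundary T)
    & exists kappa0 : R, 0 < kappa0 /\
        forall (t : 'rV[R]_d) (e : R), T t -> 0 < e -> e < 1 ->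
          ((kappa0 * e ^+ d)%:E <= lebesgue_rV (ball1 t e `&` T))%E].

(* C^k on the open set [U]: all partial derivatives of order at most k exist
   and are continuous on [U]. *)
Fixpoint Ck_on (R : realType) (d k : nat) (U : set 'rV[R]_d)
    (g : 'rV[R]_d -> R) : Prop :=
  (forall x, U x -> {for x, continuous g}) /\
  match k with
  | 0 => True
  | k'.+1 => forall i : 'I_d,
      (forall x, U x -> derivable g x (delta_mx ord0 i)) /\
      Ck_on k' U ('D_(delta_mx ord0 i) g)
  end.

(* As usual on a set that is not open, g is C^2 on [T] when it extends to a C^2
   function on some open neighbourhood of [T]. *)
Definition C2_set (R : realType) (d : nat) (T : set 'rV[R]_d)
    (g : 'rV[R]_d -> R) : Prop :=
  exists (U : set 'rV[R]_d) (h : 'rV[R]_d -> R),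
    [/\ open U, T `<=` U, Ck_on 2 U h & forall t, T t -> h t = g t].

Section random_fields.
Context (R : realType) (dO : measure_display) (Omega : measurableType dO).
Context (P : probability Omega R) (d : nat).

(* A random field on [T] is a family indexed by all of R^d of which only the
   members [f t] with [T t] are ever used: every notion below quantifies over
   points of [T] only. *)
Implicit Types (T : set 'rV[R]_d) (f : 'rV[R]_d -> {RV P >-> R}).

(* Degenerate (constant) variables count as Gaussian; they are treated apart
   because [normal_prob m 0] is not a Dirac measure in the library. *)
Definition gaussian_rv (X : Omega -> R) : Prop :=
  exists m s : R, 0 <= s /\
    forall A : set R, measurable A ->
      P (X @^-1` A) = if s == 0 then \d_m A else normal_prob m s A.

(* The finite-dimensional distributions are multivariate Gaussian, possibly
   degenerate: every linear combination is Gaussian. *)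
Definition gaussian_field T f : Prop :=
  forall (n : nat) (t : 'I_n -> 'rV[R]_d) (a : 'I_n -> R),
    (forall i, T (t i)) ->
    gaussian_rv (fun w => \sum_(i < n) a i * f (t i) w).

Definition mean_zero T f : Prop :=
  forall t, T t -> 'E_P[f t]%E = 0%E.

(* Translation invariance of the law of a field defined on [T] only: the
   finite-dimensional distributions at points of [T] are unchanged by any
   translation that keeps these points in [T]. *)
Definition homogeneous T f : Prop :=
  forall (n : nat) (t : 'I_n -> 'rV[R]_d) (h : 'rV[R]_d),
    (forall i, T (t i)) -> (forall i, T (t i + h)) ->
    forall A : set (n.-tuple R), measurable A ->
      P [set w | A [tuple f (t i + h) w | i < n]] =
      P [set w | A [tuple f (t i) w | i < n]].

Definition condition_B1 T f : Prop :=
  homogeneous T f /\ {ae P, forall w, C2_set T (fun t => f t w)}.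

Definition unique_global_max T f : Prop :=
  {ae P, forall w, exists! t, T t /\ forall s, T s -> f s w <= f t w}.

Definition sup_exceeds f (A : set 'rV[R]_d) (b : R) : set Omega :=
  [set w | (b%:E < ereal_sup [set (f t w)%:E | t in A])%E].

(* [P^*] is the outer measure of [P]; it agrees with [P] on events and with the
   completion of [P] on the completed sigma-algebra.  The event that the
   supremum over an uncountable set exceeds b need not be measurable for [P],
   but it is for the completion when the field is a.s. continuous. *)
Definition cond_prob (A B : set Omega) : \bar R :=
  ((P ^*)%mu (A `&` B) / (P ^*)%mu B)%E.

End random_fields.

(* Main.v *)
(* The theorem compares two estimates of excursion probabilities, written in
   terms of the common tail p(b) = P (f t > b) with f t centred of scale sigma.
   The union bound gives P (sup_S f > b) <= #|S| p(b).  In the other direction,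
   Bonferroni's inequality on a grid of spacing b^-alpha, theta < alpha < 1,
   inside a ball contained in T gives P (sup_T f > b) >= const b^(alpha d) p(b):
   if h = b^-alpha and the L^2 distance D s t of f s and f t is at least
   kappa h, then f s + f t has variance at most 4 sigma^2 - kappa^2 h^2, so that
   P (f s > b, f t > b) is smaller than p(b) by a factor exp (- k b^(2 - 2 alpha)).

   The bound D s t >= kappa |s - t| for close s and t is where uniqueness of the
   maximum enters.  The function D is a translation invariant pseudometric;
   hence D (c + n tau, c) <= n D (c + tau, c), and it suffices to show that
   D (c + tau, c) > 0 for small tau <> 0.  The maximizer is almost surely a point
   at positive D-distance from every other point of T.  Such points t_n exist
   with D (c, t_n) -> 0: otherwise f c > b would force f to exceed b far from c
   for D, which a chaining argument shows to be exponentially less likely than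
   f c > b.  If t_n clusters at s, then D (c, s) = 0, and by translation t_n is at
   D-distance 0 from c + (t_n - s); so these coincide, s = c, t_n is close to c,
   and D (t_n + tau, t_n) = D (c + tau, c) > 0.  Chaining needs D to be Lipschitz,
   which follows from the differentiability of the paths, since a sequence of
   centred normal variables that is almost surely bounded has bounded scales. *)

Require Import Defs.
From HB Require Import structures.
From mathcomp Require Import all_boot all_order all_algebra finmap.
From mathcomp Require Import all_classical all_reals all_analysis.
From mathcomp Require Import measurable_realfun.
From mathcomp Require Import ring lra zify.

Set Implicit Arguments.
Unset Strict Implicit.
Unset Printing Implicit Defensive.

Import Order.TTheory GRing.Theory Num.Theory.
Import numFieldNormedType.Exports.

Local Open Scope classical_set_scope.
Local Open Scope ring_scope.

(** * Normal distributions *)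

Section standard_normal.
Context {R : realType}.
Local Notation mu := (@lebesgue_measure R).
Local Notation gauss := (@normal_prob R 0 1).

(** Every normal law is treated as the image of the standard one under [affine m s]. For [s = 0] the
    map is constant, so Dirac laws are included. *)
Definition affine (m s : R) : measurableTypeR R -> R := fun x => m + s * x.

Lemma measurable_affine (m s : R) :
  measurable_fun [set: measurableTypeR R] (affine m s).
Proof. by apply: measurable_funD => //; exact: measurable_funM. Qed.

HB.instance Definition _ (m s : R) :=
  @isMeasurableFun.Build _ _ (measurableTypeR R) R (affine m s)
    (measurable_affine m s).

Lemma normal_prob_itvcy (m s a : R) : 0 < s ->
  normal_prob m s `[affine m s a, +oo[%classic = gauss `[a, +oo[%classic.
Proof.
move=> s0; rewrite /normal_prob.
have dF : derive1 (affine m s) = cst s.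
  apply/funext => x; rewrite derive1E.
  by rewrite deriveD//= deriveM//= derive_id !derive_cst scaler0 addr0 add0r scaler1.
rewrite (@increasing_ge0_integration_by_substitutiony _ (affine m s)).
- apply: eq_integral => x _; rewrite dF /= !fctE.
  congr EFin; rewrite !normal_pdfE ?gt_eqF// /normal_fun /normal_peak /affine.
  rewrite addrAC subrr add0r !subr0 expr1n mul1r exprMn.
  rewrite -mulrnAr sqrtrM ?sqr_ge0// sqrtr_sqr gtr0_norm//.
  rewrite invfM mulrC !mulrA mulfV ?gt_eqF// mul1r; congr (_ * expR _).
  by rewrite -(mulr_natr (s ^+ 2)); field; rewrite gt_eqF.
- by move=> x y _ _ xy; rewrite ltrD2l ltr_pM2l.
- by move=> x _; rewrite dF; exact: cst_continuous.
- by rewrite dF; exact: is_cvg_cst.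
- by rewrite dF; exact: is_cvg_cst.
- split.
    by move=> x _; apply: derivableD => //; exact: derivableZ.
  apply: cvg_at_right_filter; apply: cvgD; first exact: cvg_cst.
  by apply: cvgM; [exact: cvg_cst|exact: cvg_id].
- apply/cvgryPge => A.
  apply: filterS (nbhs_pinfty_ge (num_real ((A - m) / s))) => x.
  by rewrite /affine ler_pdivrMr// lerBlDl mulrC.
- apply: continuous_subspaceT; apply: continuous_normal_pdf; exact: lt0r_neq0.
- by move=> x _; exact: normal_pdf_ge0.
Qed.

(** The rays are closed under intersection and generate the Borel sets, and the rays starting at
    [- k%:R] exhaust the line. *)
Lemma probability_itvcy_unique (m1 m2 : probability R R) :
  (forall a : R, m1 `[a, +oo[%classic = m2 `[a, +oo[%classic) ->
  forall A : set R, measurable A -> m1 A = m2 A.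
Proof.
move=> H A mA.
apply: (@measure_unique _ R R (@RGenCInfty.G R)
  (fun k => `[- k%:R, +oo[%classic)) => //.
- exact: RGenCInfty.measurableE.
- move=> _ _ [x ->] [y ->]; exists (Num.max x y); apply/seteqP; split=> z /=;
    rewrite !in_itv/= !andbT ge_max.
  + by move=> [-> ->].
  + by move=> /andP[].
- by move=> k; exists (- k%:R).
- apply/seteqP; split => // x _; exists (Num.bound `|x|) => //=.
  rewrite in_itv/= andbT lerNl (le_trans (ler_norm _))// normrN.
  by rewrite ltW// archi_boundP.
- by move=> _ [a ->]; exact: H.
- by move=> k; rewrite (le_lt_trans (probability_le1 _ _)) ?ltry//.
Qed.

Lemma affine01 : affine 0 1 = id.
Proof. by apply/funext => x; rewrite /affine add0r mul1r. Qed.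

Lemma normal_prob_affine (m s : R) (A : set R) : 0 < s -> measurable A ->
  normal_prob m s A = gauss (affine m s @^-1` A).
Proof.
move=> s0 mA; rewrite -[in LHS](preimage_id A) -affine01.
have := @probability_itvcy_unique
  (distribution (normal_prob m s) (affine 0 1 : {RV (normal_prob m s) >-> R}))
  (distribution gauss (affine m s : {RV gauss >-> R})).
apply => // a; rewrite /= /distribution /pushforward affine01 preimage_id.
rewrite -[a in LHS](_ : affine m s ((a - m) / s) = a); last first.
  by rewrite /affine mulrC divfK ?gt_eqF// addrC subrK.
rewrite normal_prob_itvcy//; congr (gauss _); apply/seteqP; split => x /=;
  by rewrite !in_itv/= !andbT /affine -lerBlDl ler_pdivrMr// mulrC.
Qed.

(** The density is even; the substitution [x -> - x] shows this on rays, which suffices. *)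
Lemma normal_prob_opp (A : set R) : measurable A ->
  gauss (affine 0 (-1) @^-1` A) = gauss A.
Proof.
move=> mA; rewrite -[in RHS](preimage_id A) -affine01.
have := @probability_itvcy_unique
  (distribution gauss (affine 0 (-1) : {RV gauss >-> R}))
  (distribution gauss (affine 0 1 : {RV gauss >-> R})).
apply => // a; rewrite /= /distribution /pushforward affine01 preimage_id.
have -> : affine 0 (-1) @^-1` `[a, +oo[ = `]-oo, - a]%classic.
  by apply/seteqP; split => x /=; rewrite !in_itv/= andbT /affine add0r mulN1r lerNr.
rewrite /normal_prob ge0_integration_by_substitutionNy//.
- apply: eq_integral => x _ /=; congr EFin.
  by rewrite !normal_pdfE// /normal_fun !subr0 sqrrN.
- by apply: continuous_subspaceT; apply: continuous_normal_pdf.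
- by move=> x _; exact: normal_pdf_ge0.
Qed.

End standard_normal.

(** * Tails and second moment of the standard normal law *)

Section standard_normal_tail.
Context {R : realType}.
Local Notation mu := (@lebesgue_measure R).
Local Notation gauss := (@normal_prob R 0 1).

(* [u ^+ 2 + (x - u) ^+ 2 <= x ^+ 2] for [0 <= u <= x], so beyond [u] the standard
   density is at most [expR (- u ^+ 2 / 2)] times the density centred at [u]. *)
Lemma normal_prob_tail_le (u : R) : 0 <= u ->
  (gauss `]u, +oo[%classic <= (expR (- u ^+ 2 / 2))%:E)%E.
Proof.
move=> u0.
apply: (@le_trans _ _ (\int[mu]_(x in `]u, +oo[)
    ((expR (- u ^+ 2 / 2))%:E * (normal_pdf u 1 x)%:E))%E).
  apply: ge0_le_integral => //=.
  - by move=> x _; rewrite lee_fin normal_pdf_ge0.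
  - by apply: measurable_funTS; apply/measurable_EFinP; exact: measurable_normal_pdf.
  - apply: measurable_funTS; apply: emeasurable_funM => //.
    by apply/measurable_EFinP; exact: measurable_normal_pdf.
  - move=> x; rewrite in_itv/= andbT => ux.
    rewrite -EFinM lee_fin !normal_pdfE// /normal_fun mulrCA ler_wpM2l//.
      exact: normal_peak_ge0.
    rewrite -expRD ler_expR expr1n; nra.
rewrite ge0_integralZl//=.
- rewrite -[leRHS]mule1 lee_wpmul2l ?lee_fin ?expR_ge0//.
  exact: (@probability_le1 _ _ _ (normal_prob u 1)).
- by apply: measurable_funTS; apply/measurable_EFinP; exact: measurable_normal_pdf.
- by move=> x _; rewrite lee_fin normal_pdf_ge0.
Qed.

Lemma normal_prob_tail_ge : exists2 c : R, 0 < c & forall u : R, 1 <= u ->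
  ((c / u * expR (- u ^+ 2 / 2))%:E <= gauss `]u, +oo[%classic)%E.
Proof.
(* On []u, u + u^-1]] one has [x ^+ 2 <= u ^+ 2 + 3], because [u^-1 <= 1]. This bounds the density
   from below on an interval of length [u^-1]. *)
exists (normal_peak 1 * expR (- 3 / 2)).
  by rewrite mulr_gt0 ?normal_peak_gt0 ?expR_gt0.
move=> u u1; have u0 : 0 < u by exact: lt_le_trans u1.
apply: (@le_trans _ _ (\int[mu]_(x in `]u, (u + u^-1)%R])
    (normal_peak 1 * expR (- 3 / 2) * expR (- u ^+ 2 / 2))%:E)%E).
  rewrite integral_cst//= lebesgue_measure_itv/= lte_fin ltrDl invr_gt0 u0.
  by rewrite -EFinD -EFinM lee_fin addrAC subrr add0r mulrAC.
apply: (@le_trans _ _ (gauss `]u, (u + u^-1)%R]%classic)); last first.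
  by apply: le_measure; rewrite ?inE//; exact: subset_itvl.
apply: ge0_le_integral => //=.
- by move=> x _; rewrite lee_fin !mulr_ge0 ?normal_peak_ge0 ?expR_ge0.
- by apply: measurable_funTS; apply/measurable_EFinP; exact: measurable_normal_pdf.
- move=> x; rewrite in_itv/= => /andP[ux xu].
  rewrite lee_fin normal_pdfE// /normal_fun -mulrA ler_wpM2l ?normal_peak_ge0//.
  rewrite -expRD ler_expR expr1n subr0.
  have x0 : 0 <= x by lra.
  have v1 : u^-1 <= 1 by rewrite invf_le1.
  have v0 : 0 < u^-1 by rewrite invr_gt0.
  have uv : u * u^-1 = 1 by rewrite divff// gt_eqF.
  have : x ^+ 2 <= (u + u^-1) ^+ 2 by rewrite ler_sqr// nnegrE; lra.
  rewrite sqrrD uv; move: (u^-1) v0 v1 => v v0 v1 h.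
  have : v ^+ 2 <= 1 by nra.
  by lra.
Qed.

Lemma measurable_sqr_EFin :
  measurable_fun [set: measurableTypeR R] (fun x : R => (x ^+ 2)%:E).
Proof. by apply/measurable_EFinP; exact: measurable_funX. Qed.

(** Layer cake formula: the square exceeds [r] with probability at most [2 * expR (- r / 2)],
    counting both tails, and this is 4 times the exponential density of rate 1/2. *)
Lemma normal_prob_moment2_lty : (\int[gauss]_x (x ^+ 2)%:E < +oo)%E.
Proof.
pose sq : measurableTypeR R -> R := fun x => x ^+ 2.
have msq : measurable_fun setT sq by exact: measurable_funX.
pose X : {RV gauss >-> R} := mfun_Sub (mem_set msq).
rewrite -(expectation_def (X : {RV gauss >-> R})).
rewrite ge0_expectation_ccdf; last by move=> x; exact: sqr_ge0.
have mexp : measurable_fun [set: measurableTypeR R]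
    (fun r => (exponential_pdf (2^-1 : R) r)%:E).
  by apply/measurable_EFinP; exact: measurable_exponential_pdf.
apply: (@le_lt_trans _ _ (\int[mu]_(r in `[0%R, +oo[)
    (4%:E * (exponential_pdf (2^-1 : R) r)%:E))%E).
  apply: ge0_le_integral => //=.
  - by apply: measurable_funTS; exact: ccdf_measurable.
  - by apply: measurable_funTS; apply: emeasurable_funM.
  - move=> r; rewrite in_itv/= andbT => r0.
    rewrite exponential_pdfE// -EFinM mulrA.
    have -> : 4 * 2^-1 = 2 :> R by lra.
    rewrite /ccdf /distribution /pushforward/=.
    pose A := `]Num.sqrt r, +oo[%classic : set R.
    have mA : measurable A by exact: measurable_itv.
    have mB : measurable (affine 0 (-1) @^-1` A).
      by rewrite -[X in measurable X]setTI; exact: measurable_affine.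
    apply: (@le_trans _ _ (gauss (A `|` affine 0 (-1) @^-1` A))).
      apply: le_measure; rewrite ?inE; first 1 last.
      + exact: measurableU.
      + move=> x /=; rewrite in_itv/= andbT => rx.
        have [x0|x0] := leP 0 x; [left|right].
          rewrite /A/= in_itv/= andbT -[ltRHS](ger0_norm x0) -sqrtr_sqr.
          by rewrite ltr_sqrt// (le_lt_trans r0).
        rewrite /A/= in_itv/= andbT /affine add0r mulN1r.
        rewrite -[ltRHS](gtr0_norm (_ : 0 < - x)) ?oppr_gt0// -sqrtr_sqr sqrrN.
        by rewrite ltr_sqrt// (le_lt_trans r0).
      + by rewrite -[Y in measurable Y]setTI; apply (msq measurableT); exact: measurable_itv.
    have hU : (gauss (A `|` affine 0 (-1) @^-1` A) <=
        gauss A + gauss (affine 0 (-1) @^-1` A))%E by exact: measureU2.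
    apply: (le_trans hU).
    rewrite normal_prob_opp//.
    have /= h := normal_prob_tail_le (sqrtr_ge0 r).
    apply: (le_trans (leeD h h)).
    rewrite -EFinD lee_fin sqr_sqrtr//.
    have -> : - r / 2 = - 2^-1 * r by lra.
    by lra.
rewrite ge0_integralZl//=.
- rewrite lte_mul_pinfty//.
  apply: (@le_lt_trans _ _ (\int[mu]_r (exponential_pdf (2^-1 : R) r)%:E)%E).
    apply: ge0_subset_integral => //.
    by move=> r _; rewrite lee_fin exponential_pdf_ge0//.
  by rewrite integral_exponential_pdf ?ltry.
- exact: measurable_funTS.
- by move=> r _; rewrite lee_fin exponential_pdf_ge0.
Qed.

Lemma normal_prob_moment2_gt0 : (0 < \int[gauss]_x (x ^+ 2)%:E)%E.
Proof.
have [c c0 /(_ 1 (lexx _)) h] := normal_prob_tail_ge.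
apply: (@lt_le_trans _ _ (gauss `]1, +oo[%classic)).
  by apply: lt_le_trans h; rewrite lte_fin divr1 mulr_gt0 ?expR_gt0.
rewrite -[X in gauss X]setIT -integral_indic//.
apply: ge0_le_integral => //=.
- by apply/measurable_EFinP; exact: measurable_indic.
- exact: measurable_sqr_EFin.
- move=> x _; rewrite lee_fin indicE.
  have [|_] := boolP (x \in _); last exact: sqr_ge0.
  rewrite inE/= in_itv/= andbT => x1; nra.
Qed.

End standard_normal_tail.

(** * Change of variables to the standard normal law *)

Section integral_law.
Context {R : realType} {dO : measure_display} {Omega : measurableType dO}.
Variables (P : probability Omega R) (X : Omega -> R) (m s : R).
Local Notation gauss := (@normal_prob R 0 1).
Hypotheses (mX : measurable_fun setT X) (H : forall A : set R, measurable A ->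
  P (X @^-1` A) = gauss (affine m s @^-1` A)).

Lemma ge0_integral_law (g : R -> \bar R) :
  measurable_fun setT g -> (forall x, 0 <= g x)%E ->
  (\int[P]_w g (X w) = \int[gauss]_x g (affine m s x))%E.
Proof.
move=> mg g0.
have := @ge0_integral_pushforward _ _ _ _ R X mX P setT g measurableT mg (fun x _ => g0 x).
have := @ge0_integral_pushforward _ _ _ _ R (affine m s) (measurable_affine m s) gauss
  setT g measurableT mg (fun x _ => g0 x).
rewrite !preimage_setT => <- <-.
by apply: eq_measure_integral => A mA _; exact: H.
Qed.

Lemma integral_law (g : R -> \bar R) : measurable_fun setT g ->
  (\int[P]_w g (X w) = \int[gauss]_x g (affine m s x))%E.
Proof.
move=> mg; rewrite [LHS]integralE [RHS]integralE; congr (_ - _)%E.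
  transitivity (\int[P]_w (g^\+ (X w)))%E.
    by apply: eq_integral => w _; rewrite !funeposE.
  rewrite ge0_integral_law//; last exact: measurable_funepos.
  by apply: eq_integral => w _; rewrite !funeposE.
transitivity (\int[P]_w (g^\- (X w)))%E.
  by apply: eq_integral => w _; rewrite !funenegE.
rewrite ge0_integral_law//; last exact: measurable_funeneg.
by apply: eq_integral => w _; rewrite !funenegE.
Qed.

End integral_law.

(** * Centred normal variables: scale, second moment, tails *)

Section gaussian_variable.
Context {R : realType} {dO : measure_display} {Omega : measurableType dO}.
Variable P : probability Omega R.
Local Notation gauss := (@normal_prob R 0 1).

(* The value is 1, but only its positivity and finiteness matter: [scale] below
   recovers the parameter of a centred normal variable by normalising with it. *)
Definition moment2 : \bar R := (\int[gauss]_x (x ^+ 2)%:E)%E.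

(** The value [s = 0] is allowed and means the Dirac law at 0, so differences of values of the field
    that vanish almost surely need no separate notion. *)
Definition centered_normal (X : Omega -> R) (s : R) : Prop :=
  0 <= s /\ forall A : set R, measurable A ->
    P (X @^-1` A) = gauss (affine 0 s @^-1` A).

Definition scale (X : Omega -> R) : R :=
  Num.sqrt (fine (\int[P]_w (X w ^+ 2)%:E)%E / fine moment2).

Lemma moment2_gt0 : 0 < fine moment2.
Proof. by rewrite fine_gt0// normal_prob_moment2_gt0 normal_prob_moment2_lty. Qed.

Lemma moment2E : moment2 = (fine moment2)%:E.
Proof.
by rewrite fineK// ge0_fin_numE ?normal_prob_moment2_lty// ltW// normal_prob_moment2_gt0.
Qed.

Lemma gaussian_law (X : Omega -> R) : gaussian_rv P X -> exists m s : R, 0 <= s /\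
  forall A : set R, measurable A -> P (X @^-1` A) = gauss (affine m s @^-1` A).
Proof.
move=> [m [s [s0 H]]]; exists m, s; split=> // A mA; rewrite H//.
case: eqP => [->|/eqP sn0]; last first.
  by rewrite normal_prob_affine// lt_neqAle eq_sym sn0.
have aE : affine m 0 = cst m by apply/funext => x; rewrite /affine mul0r addr0.
rewrite aE preimage_cst diracE.
by have [mAm|mAm] := boolP (m \in A); rewrite ?probability_setT// measure0.
Qed.

Lemma integrable_normal_id :
  gauss.-integrable setT (fun x : measurableTypeR R => x%:E).
Proof.
apply: (@le_integrable _ _ _ _ setT _ _ (fun x : measurableTypeR R => (1 + x ^+ 2)%:E)) => //.
- exact/measurable_EFinP.
- move=> x _ /=; rewrite lee_fin (ger0_norm (_ : 0 <= 1 + x ^+ 2)); last first.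
    by rewrite addr_ge0// sqr_ge0.
  rewrite -(real_normK (num_real x)); move: `|x| (normr_ge0 x) => y y0; nra.
- apply/integrableP; split.
    by apply/measurable_EFinP; apply: measurable_funD => //; exact: measurable_funX.
  under eq_integral => x _.
    rewrite gee0_abs ?lee_fin ?addr_ge0 ?sqr_ge0// EFinD; over.
  rewrite ge0_integralD//=; last 2 first.
    by move=> x _; rewrite lee_fin sqr_ge0.
    exact: measurable_sqr_EFin.
  rewrite integral_cst// lte_add_pinfty ?normal_prob_moment2_lty//.
  by rewrite mul1e (le_lt_trans (probability_le1 _ _)) ?ltry.
Qed.

(** By symmetry of the law the integral, which is finite, equals its own opposite. *)
Lemma integral_normal_id : (\int[gauss]_x x%:E = 0)%E.
Proof.
have mid : measurable_fun [set: R] (fun x : R => x%:E) by exact/measurable_EFinP.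
have fE : (\int[gauss]_x x%:E)%E \is a fin_num.
  exact: integrable_fin_num integrable_normal_id.
suff : (\int[gauss]_x x%:E = - \int[gauss]_x x%:E)%E.
  by case: (\int[gauss]_x x%:E)%E fE => // r _ [] rr; congr EFin; lra.
rewrite -integralN/=; last exact: integrable_add_def integrable_normal_id.
have := @integral_law _ _ _ gauss (affine 0 1) 0 (-1) (measurable_affine _ _) _
  (fun x : R => x%:E) mid.
rewrite affine01 => -> => [|A mA]; last by rewrite normal_prob_opp// preimage_id.
by apply: eq_integral => x _; rewrite /affine add0r mulN1r.
Qed.

Lemma gaussian_integrable (X : Omega -> R) : measurable_fun setT X ->
  gaussian_rv P X -> P.-integrable setT (EFin \o X).
Proof.
move=> mX /gaussian_law[m [s [s0 H]]]; apply/integrableP; split; first exact/measurable_EFinP.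
have := @ge0_integral_law _ _ _ P X m s mX H (fun x => `|x%:E|)%E.
move=> ->//; last by apply: measurableT_comp => //; exact/measurable_EFinP.
apply: (@le_lt_trans _ _ (\int[gauss]_x ((`|m|)%:E + s%:E * `|x%:E|))%E).
  apply: ge0_le_integral => //=.
  - by apply/measurable_EFinP; apply: measurableT_comp => //; exact: measurable_affine.
  - apply: emeasurable_funD => //; apply: emeasurable_funM => //.
    by apply: measurableT_comp => //; exact/measurable_EFinP.
  - move=> x _; rewrite lee_fin /affine (le_trans (ler_normD _ _))// lerD2l.
    by rewrite normrM (ger0_norm s0).
rewrite ge0_integralD//=; last 2 first.
  by move=> x _; rewrite mule_ge0.
  apply: emeasurable_funM => //.
  by apply: measurableT_comp => //; exact/measurable_EFinP.
rewrite integral_cst// ge0_integralZl//; last first.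
  by apply: measurableT_comp => //; exact/measurable_EFinP.
rewrite lte_add_pinfty//.
  by rewrite lte_mul_pinfty// (le_lt_trans (probability_le1 _ _)) ?ltry.
by rewrite lte_mul_pinfty//; have /integrableP[] := integrable_normal_id.
Qed.

Lemma gaussian_centered (X : Omega -> R) : measurable_fun setT X ->
  gaussian_rv P X -> (\int[P]_w (X w)%:E = 0)%E -> exists s, centered_normal X s.
Proof.
move=> mX /gaussian_law[m [s [s0 H]]] E0.
suff m0 : m = 0 by rewrite m0 in H; exists s.
move: E0; rewrite (@integral_law _ _ _ P X m s mX H (fun x => x%:E)); last exact/measurable_EFinP.
under eq_integral do rewrite /affine EFinD EFinM.
rewrite integralD//=; last 2 first.
  by apply: finite_measure_integrable_cst.
  exact: integrableZl integrable_normal_id.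
have g1 : gauss setT = 1%E by exact: probability_setT.
rewrite integral_cst// [X in (_ * X + _)%E]g1 mule1 integralZl//; last exact: integrable_normal_id.
by rewrite integral_normal_id mule0 adde0 => -[].
Qed.

Lemma centered_normal_moment2 (X : Omega -> R) (s : R) : measurable_fun setT X ->
  centered_normal X s -> (\int[P]_w (X w ^+ 2)%:E = (s ^+ 2 * fine moment2)%:E)%E.
Proof.
move=> mX [s0 H].
rewrite (@ge0_integral_law _ _ _ P X 0 s mX H (fun x => (x ^+ 2)%:E)); last 2 first.
- by apply/measurable_EFinP; exact: measurable_funX.
- by move=> x; rewrite lee_fin sqr_ge0.
under eq_integral do rewrite /affine add0r exprMn EFinM.
rewrite ge0_integralZl//=; first by rewrite [in RHS]EFinM -moment2E.
- exact: measurable_sqr_EFin.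
- by move=> x _; rewrite lee_fin sqr_ge0.
- by rewrite lee_fin sqr_ge0.
Qed.

(** The second moment determines [s], so the scale is unique and may be used as a function of the
    variable. *)
Lemma centered_normal_scale (X : Omega -> R) (s : R) : measurable_fun setT X ->
  centered_normal X s -> scale X = s.
Proof.
move=> mX Xs; rewrite /scale (centered_normal_moment2 mX Xs)/=.
by rewrite mulfK ?gt_eqF ?moment2_gt0// sqrtr_sqr ger0_norm//; case: Xs.
Qed.

Lemma centered_normal_tail (X : Omega -> R) (s u : R) : 0 < s ->
  centered_normal X s -> P [set w | u < X w] = gauss `]u / s, +oo[%classic.
Proof.
move=> s0 [_ H].
have -> : [set w | u < X w] = X @^-1` `]u, +oo[%classic.
  by apply/seteqP; split => w /=; rewrite in_itv/= andbT.
rewrite H//; congr (gauss _); apply/seteqP; split => x /=;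
  by rewrite !in_itv/= !andbT /affine add0r ltr_pdivrMr// mulrC.
Qed.

Lemma centered_normal_tail0 (X : Omega -> R) (u : R) : 0 <= u ->
  centered_normal X 0 -> P [set w | u < X w] = 0%E.
Proof.
move=> u0 [_ H].
have -> : [set w | u < X w] = X @^-1` `]u, +oo[%classic.
  by apply/seteqP; split => w /=; rewrite in_itv/= andbT.
rewrite H// [X in gauss X](_ : _ = set0) ?measure0// -subset0 => x /=.
by rewrite in_itv/= andbT /affine mul0r addr0 ltNge u0.
Qed.

(** The bound is in terms of some [v > 0] above the variance: this admits [s = 0] and variances that
    are only estimated. *)
Lemma centered_normal_tail_le (X : Omega -> R) (s u v : R) : 0 <= u -> 0 < v ->
  s ^+ 2 <= v -> centered_normal X s ->
  (P [set w | (u < X w)%R] <= (expR (- (u ^+ 2 / (2 * v))))%:E)%E.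
Proof.
move=> u0 v0 sv Xs; have := Xs.1; rewrite le_eqVlt => /predU1P[s0|s0].
  by rewrite -s0 in Xs; rewrite centered_normal_tail0// lee_fin expR_ge0.
rewrite (centered_normal_tail _ s0 Xs).
apply: le_trans (normal_prob_tail_le (divr_ge0 u0 (ltW s0))) _.
rewrite lee_fin ler_expR mulNr lerN2.
have -> : (u / s) ^+ 2 / 2 = u ^+ 2 / (2 * s ^+ 2) by field; rewrite gt_eqF.
rewrite ler_wpM2l ?sqr_ge0// lef_pV2 ?posrE ?mulr_gt0 ?exprn_gt0//.
by rewrite ler_wpM2l.
Qed.

(** One constant serves all variables and scales. At [u = s] the bound is a positive number that
    does not depend on [s]. *)
Lemma centered_normal_tail_ge : exists2 c : R, 0 < c &
  forall (X : Omega -> R) (s u : R), 0 < s -> s <= u -> centered_normal X s ->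
  ((c * s / u * expR (- (u ^+ 2 / (2 * s ^+ 2))))%:E <= P [set w | (u < X w)%R])%E.
Proof.
have [c c0 H] := @normal_prob_tail_ge R; exists c => // X s u s0 su Xs.
rewrite (centered_normal_tail _ s0 Xs).
have u0 : 0 < u by exact: lt_le_trans su.
have := H (u / s); rewrite ler_pdivlMr// mul1r => /(_ su).
congr (_ <= _)%E; congr EFin; congr (_ * expR _).
  by rewrite invf_div mulrA.
by rewrite mulNr; congr (- _); field; rewrite gt_eqF.
Qed.

End gaussian_variable.

(** * The pseudometric of a homogeneous Gaussian field *)

Section centered_normal_calculus.
Context {R : realType} {dO : measure_display} {Omega : measurableType dO}.
Variable P : probability Omega R.
Local Notation V0 := (fine (@moment2 R)).

Lemma centered_normal_eq (X Y : Omega -> R) (s : R) :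
  (forall A : set R, measurable A -> P (Y @^-1` A) = P (X @^-1` A)) ->
  centered_normal P X s -> centered_normal P Y s.
Proof. by move=> XY [s0 H]; split=> // A mA; rewrite XY// H. Qed.

Lemma centered_normal0_ae (X : Omega -> R) : measurable_fun setT X ->
  centered_normal P X 0 -> {ae P, forall w, X w = 0}.
Proof.
move=> mX [_ H]; exists (X @^-1` ~` [set 0]); split.
- rewrite -[Y in measurable Y]setTI; apply: mX => //.
  by apply: measurableC; exact: measurable_set1.
- rewrite H; last by apply: measurableC; exact: measurable_set1.
  rewrite [Y in normal_prob _ _ Y](_ : _ = set0) ?measure0// -subset0 => x /=.
  by rewrite /affine mul0r addr0.
- by move=> w /=; exact.
Qed.

(** The infimum over [a] of the right-hand side is [(s + t) ^+ 2]. In this form Minkowski's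
    inequality follows from a pointwise inequality for each [a]. *)
Lemma square_sum_le (s t r : R) : 0 <= s -> 0 <= t ->
  (forall a, 0 < a -> r ^+ 2 <= (1 + a) * s ^+ 2 + (1 + a^-1) * t ^+ 2) ->
  r <= s + t.
Proof.
move=> s0 t0 H; have [r0|r0] := leP r 0; first by rewrite (le_trans r0)// addr_ge0.
suff h : r ^+ 2 <= (s + t) ^+ 2.
  by rewrite -ler_sqr ?nnegrE ?addr_ge0// ltW.
apply/ler_addgt0Pr => e e0.
(* [a = t / s] is optimal; [k] avoids dividing by 0. *)
pose k := e / (s + t + e + 1).
have D0 : 0 < s + t + e + 1 by lra.
have k0 : 0 < k by rewrite divr_gt0.
have kD : k * (s + t + e + 1) = e by rewrite /k divfK// gt_eqF.
have k1 : k < 1 by rewrite /k ltr_pdivrMr// mul1r; lra.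
have sk : 0 < s + k by lra.
have tk : 0 < t + k by lra.
have := H ((t + k) / (s + k)); rewrite divr_gt0// => /(_ isT) /le_trans; apply.
rewrite invf_div !mulrDl !mul1r.
have h1 : (t + k) / (s + k) * s ^+ 2 <= (t + k) * s.
  rewrite expr2 mulrA ler_wpM2r// -mulrA ler_piMr; [by []|lra|].
  by rewrite mulrC ler_pdivrMr// mul1r; lra.
have h2 : (s + k) / (t + k) * t ^+ 2 <= (s + k) * t.
  rewrite expr2 mulrA ler_wpM2r// -mulrA ler_piMr; [by []|lra|].
  by rewrite mulrC ler_pdivrMr// mul1r; lra.
have ke : 0 <= k * e by rewrite mulr_ge0// ltW.
lra.
Qed.

Lemma centered_normal_add_le (X Y : Omega -> R) (s t r : R) :
  measurable_fun setT X -> measurable_fun setT Y ->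
  centered_normal P X s -> centered_normal P Y t ->
  centered_normal P (fun w => X w + Y w) r -> r <= s + t.
Proof.
move=> mX mY Xs Yt XYr; apply: square_sum_le => [||a a0]; [exact: Xs.1|exact: Yt.1|].
have mXY : measurable_fun setT (fun w => X w + Y w) by exact: measurable_funD.
have msq (Z : Omega -> R) : measurable_fun setT Z -> measurable_fun setT (fun w => (Z w ^+ 2)%:E).
  by move=> mZ; apply/measurable_EFinP; exact: measurable_funX.
suff : ((r ^+ 2 * V0)%:E <= (1 + a)%:E * (s ^+ 2 * V0)%:E +
    (1 + a^-1)%:E * (t ^+ 2 * V0)%:E)%E.
  by rewrite -!EFinM -EFinD lee_fin !mulrA -mulrDl ler_pM2r ?moment2_gt0.
rewrite -(centered_normal_moment2 mX Xs) -(centered_normal_moment2 mY Yt).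
rewrite -(centered_normal_moment2 mXY XYr).
have av0 : 0 <= a^-1 by rewrite invr_ge0 ltW.
rewrite -!ge0_integralZl//; first last.
- by rewrite lee_fin; lra.
- by move=> w _; rewrite lee_fin sqr_ge0.
- exact: msq.
- by rewrite lee_fin; lra.
- by move=> w _; rewrite lee_fin sqr_ge0.
- exact: msq.
rewrite -ge0_integralD//; first last.
- by apply: emeasurable_funM => //; exact: msq.
- by move=> w _; rewrite mule_ge0// lee_fin ?sqr_ge0//; lra.
- by apply: emeasurable_funM => //; exact: msq.
- by move=> w _; rewrite mule_ge0// lee_fin ?sqr_ge0//; lra.
apply: ge0_le_integral => //.
- by move=> w _; rewrite lee_fin sqr_ge0.
- exact: msq.
- by apply: emeasurable_funD; apply: emeasurable_funM => //; exact: msq.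
move=> w _; rewrite -!EFinM -EFinD lee_fin.
have aa : a * a^-1 = 1 by rewrite divff// gt_eqF.
(* This square is exactly the difference of the two integrands. *)
have : 0 <= a^-1 * (a * X w - Y w) ^+ 2 by rewrite mulr_ge0// sqr_ge0.
have -> : a^-1 * (a * X w - Y w) ^+ 2 = a * X w ^+ 2 + a^-1 * Y w ^+ 2 - 2 * X w * Y w.
  by field; rewrite gt_eqF.
nra.
Qed.

(** The parallelogram law in L^2; it yields the variance of a sum from that of the difference,
    without covariances. *)
Lemma centered_normal_parallelogram (X Y : Omega -> R) (s t r q : R) :
  measurable_fun setT X -> measurable_fun setT Y ->
  centered_normal P X s -> centered_normal P Y t ->
  centered_normal P (fun w => X w + Y w) r ->
  centered_normal P (fun w => X w - Y w) q ->
  r ^+ 2 + q ^+ 2 = 2 * s ^+ 2 + 2 * t ^+ 2.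
Proof.
move=> mX mY Xs Yt XYr XYq.
have mXD : measurable_fun setT (fun w => X w + Y w) by exact: measurable_funD.
have mXB : measurable_fun setT (fun w => X w - Y w) by exact: measurable_funB.
have msq (Z : Omega -> R) : measurable_fun setT Z -> measurable_fun setT (fun w => (Z w ^+ 2)%:E).
  by move=> mZ; apply/measurable_EFinP; exact: measurable_funX.
suff : ((r ^+ 2 * V0)%:E + (q ^+ 2 * V0)%:E =
    2%:E * (s ^+ 2 * V0)%:E + 2%:E * (t ^+ 2 * V0)%:E)%E.
  rewrite -!EFinM -!EFinD => -[]; rewrite !mulrA -!mulrDl.
  exact: (mulIf (lt0r_neq0 (@moment2_gt0 R))).
rewrite -(centered_normal_moment2 mX Xs) -(centered_normal_moment2 mY Yt).
rewrite -(centered_normal_moment2 mXD XYr) -(centered_normal_moment2 mXB XYq).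
rewrite -!ge0_integralZl//; 
  do ?[exact: msq|by move=> w _; rewrite lee_fin sqr_ge0|by rewrite lee_fin].
have mZ (Z : Omega -> R) : measurable_fun setT Z ->
    measurable_fun setT (fun w => (2%:E * (Z w ^+ 2)%:E)%E).
  by move=> mZ; apply: emeasurable_funM => //; exact: msq.
rewrite -!ge0_integralD//; 
  do ?[exact: msq|exact: mZ|by move=> w _; rewrite mule_ge0// lee_fin sqr_ge0].
- by apply: eq_integral => w _; rewrite -!EFinM -!EFinD; congr EFin; ring.
- by move=> w _; rewrite lee_fin sqr_ge0.
- by move=> w _; rewrite lee_fin sqr_ge0.
Qed.

End centered_normal_calculus.

Section field_scale.
Context {R : realType} {dO : measure_display} {Omega : measurableType dO}.
Context {P : probability Omega R} {d : nat} {T : set 'rV[R]_d}.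
Context {f : 'rV[R]_d -> {RV P >-> R}}.
Hypotheses (gf : gaussian_field T f) (mz : mean_zero T f) (hom : homogeneous T f).
Hypothesis T0 : T 0.
Hypothesis var0 : (0 < 'V_P[f 0])%E.

(** This is the pseudometric [D] of the overview: the L^2 distance up to a fixed normalisation. *)
Definition fdist (s t : 'rV[R]_d) : R := scale P (fun w => f s w - f t w).

Definition fsum (s t : 'rV[R]_d) : R := scale P (fun w => f s w + f t w).

Definition fscale : R := scale P (f 0).

Lemma measurable_field (s : 'rV[R]_d) : measurable_fun setT (f s).
Proof. exact: measurable_funPT. Qed.

Lemma gaussian_field_comb (a b : R) (s t : 'rV[R]_d) : T s -> T t ->
  gaussian_rv P (fun w => a * f s w + b * f t w).
Proof.
move=> Ts Tt.
have := @gf 2 (fun i => if i == ord0 then s else t) (fun i => if i == ord0 then a else b).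
rewrite (_ : (fun w => _) = (fun w => a * f s w + b * f t w)).
  by apply => i; case: ifP.
by apply/funext => w; rewrite !big_ord_recl big_ord0 /= addr0.
Qed.

Lemma integrable_field (s : 'rV[R]_d) : T s -> P.-integrable setT (EFin \o f s).
Proof.
move=> Ts; apply: gaussian_integrable; first exact: measurable_field.
have := gaussian_field_comb 1 0 Ts Ts.
by rewrite (_ : (fun w => _) = f s)//; apply/funext => w; rewrite mul1r mul0r addr0.
Qed.

Lemma centered_normal_comb (a b : R) (s t : 'rV[R]_d) : T s -> T t ->
  centered_normal P (fun w => a * f s w + b * f t w)
    (scale P (fun w => a * f s w + b * f t w)).
Proof.
move=> Ts Tt.
have mX : measurable_fun setT (fun w => a * f s w + b * f t w).
  by apply: measurable_funD; apply: measurable_funM => //; exact: measurable_field.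
have [r Xr] : exists r, centered_normal P (fun w => a * f s w + b * f t w) r.
  apply: gaussian_centered => //; first exact: gaussian_field_comb.
  under eq_integral do rewrite EFinD !EFinM.
  have E0 u : T u -> (\int[P]_w (f u w)%:E = 0)%E.
    by move=> Tu; rewrite -expectation_def; exact: mz.
  rewrite integralD//=; last 2 first.
  - exact: integrableZl (integrable_field Ts).
  - exact: integrableZl (integrable_field Tt).
  rewrite !integralZl//; [|exact: integrable_field|exact: integrable_field].
  by rewrite !E0// !mule0 adde0.
by rewrite (centered_normal_scale mX Xr).
Qed.

Lemma fdistP (s t : 'rV[R]_d) : T s -> T t ->
  centered_normal P (fun w => f s w - f t w) (fdist s t).
Proof.
move=> Ts Tt; have := centered_normal_comb 1 (-1) Ts Tt.
rewrite (_ : (fun w => _) = (fun w => f s w - f t w))//.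
by apply/funext => w; rewrite mul1r mulN1r.
Qed.

Lemma fsumP (s t : 'rV[R]_d) : T s -> T t ->
  centered_normal P (fun w => f s w + f t w) (fsum s t).
Proof.
move=> Ts Tt; have := centered_normal_comb 1 1 Ts Tt.
rewrite (_ : (fun w => _) = (fun w => f s w + f t w))//.
by apply/funext => w; rewrite !mul1r.
Qed.

(** Homogeneity for the single point 0 and the translation [t] gives all values of the field the
    same law. *)
Lemma fscaleP (t : 'rV[R]_d) : T t -> centered_normal P (f t) fscale.
Proof.
move=> Tt.
have H0 : centered_normal P (f 0) fscale.
  have := centered_normal_comb 1 0 T0 T0.
  by rewrite (_ : (fun w => _) = f 0)//; apply/funext => w; rewrite mul1r mul0r addr0.
apply: centered_normal_eq H0 => A mA.
have := @hom 1 (fun=> 0) t (fun=> T0).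
rewrite add0r => /(_ (fun=> Tt) ((fun x : 1.-tuple R => tnth x ord0) @^-1` A)).
have mB : measurable ((fun x : 1.-tuple R => tnth x ord0) @^-1` A).
  by rewrite -[Y in measurable Y]setTI; exact: measurable_tnth.
move=> /(_ mB); rewrite /preimage/=.
by under eq_set do rewrite tnth_mktuple; under [in RHS]eq_set do rewrite tnth_mktuple.
Qed.

Lemma fscale_gt0 : 0 < fscale.
Proof.
have [s0 _] := fscaleP T0; rewrite lt_neqAle s0 andbT eq_sym; apply/eqP => sE.
move: var0; rewrite /variance unlock mz//=.
rewrite [X in ('E_P[X])%E](_ : _ = (fun w => f 0 w ^+ 2)); last first.
  by apply/funext => w; rewrite !fctE/= subr0 expr2.
rewrite unlock (centered_normal_moment2 (measurable_field 0) (fscaleP T0)).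
by rewrite sE expr0n/= mul0r ltxx.
Qed.

Lemma fdist_ge0 (s t : 'rV[R]_d) : 0 <= fdist s t.
Proof. exact: sqrtr_ge0. Qed.

Lemma fdistC (s t : 'rV[R]_d) : fdist s t = fdist t s.
Proof.
rewrite /fdist /scale; congr (Num.sqrt (fine _ / _)).
by apply: eq_integral => w _; rewrite -sqrrN opprB.
Qed.

Lemma fdistxx (s : 'rV[R]_d) : fdist s s = 0.
Proof.
rewrite /fdist /scale (_ : (\int[P]_w _)%E = 0%E) ?mul0r ?sqrtr0//.
by apply: integral0_eq => w _; rewrite subrr expr0n.
Qed.

Lemma fdist_triangle (t s u : 'rV[R]_d) : T s -> T t -> T u ->
  fdist s u <= fdist s t + fdist t u.
Proof.
move=> Ts Tt Tu.
apply: centered_normal_add_le (fdistP Ts Tt) (fdistP Tt Tu) _.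
- by apply: measurable_funB; exact: measurable_field.
- by apply: measurable_funB; exact: measurable_field.
have := fdistP Ts Tu.
rewrite (_ : (fun w => f s w - f t w + (f t w - f u w)) = (fun w => f s w - f u w))//.
by apply/funext => w; rewrite addrA subrK.
Qed.

Lemma fsum_sqr (s t : 'rV[R]_d) : T s -> T t ->
  fsum s t ^+ 2 = 4 * fscale ^+ 2 - fdist s t ^+ 2.
Proof.
move=> Ts Tt.
have := centered_normal_parallelogram (measurable_field s) (measurable_field t)
  (fscaleP Ts) (fscaleP Tt) (fsumP Ts Tt) (fdistP Ts Tt).
by lra.
Qed.

(** Homogeneity is applied to a pair of points and to the preimage of [A] under the difference of
    the two coordinates. *)
Lemma fdist_translate (h s t : 'rV[R]_d) : T s -> T t -> T (s + h) -> T (t + h) ->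
  fdist (s + h) (t + h) = fdist s t.
Proof.
move=> Ts Tt Tsh Tth.
have mX : measurable_fun setT (fun w => f (s + h) w - f (t + h) w).
  by apply: measurable_funB; exact: measurable_field.
apply: (centered_normal_scale mX).
apply: centered_normal_eq (fdistP Ts Tt) => A mA.
have := @hom 2 (fun i => if i == ord0 then s else t) h.
have H1 i : T (if i == ord0 :> 'I_2 then s else t) by case: ifP.
have H2 i : T ((if i == ord0 :> 'I_2 then s else t) + h) by case: ifP.
move=> /(_ H1 H2).
pose i1 : 'I_2 := lift ord0 ord0.
pose g (x : 2.-tuple R) : R := tnth x ord0 - tnth x i1.
have mB : measurable (g @^-1` A).
  rewrite -[Y in measurable Y]setTI.
  by apply: measurable_funB => //; exact: measurable_tnth.
move=> /(_ _ mB); rewrite /preimage /g/=.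
by under eq_set do rewrite !tnth_mktuple/=; under [in RHS]eq_set do rewrite !tnth_mktuple/=.
Qed.

Lemma fdist0_ae (s t : 'rV[R]_d) : T s -> T t -> fdist s t = 0 ->
  {ae P, forall w, f s w = f t w}.
Proof.
move=> Ts Tt st0; have := fdistP Ts Tt; rewrite st0 => /centered_normal0_ae.
have mX : measurable_fun setT (fun w => f s w - f t w).
  by apply: measurable_funB; exact: measurable_field.
by move=> /(_ mX); apply: filterS => w /eqP; rewrite subr_eq0 => /eqP.
Qed.

End field_scale.

(** * Finite nets, cluster points, continuity on a set, union bounds *)

Lemma rV_norm_le (R : realType) (n : nat) (x : 'rV[R]_n) (e : R) : 0 <= e ->
  (`|x| <= e) <-> (forall i, `|x ord0 i| <= e).
Proof.
move=> e0; have -> : `|x| = mx_norm x by [].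
rewrite mx_normrE; split=> [H i|H].
  by apply: le_trans H; exact: (@le_bigmax _ _ _ _ (fun ij => `|x ij.1 ij.2|) (ord0, i)).
by apply/bigmax_leP; split => // -[i j] _ /=; rewrite (ord1 i).
Qed.

Lemma rV_coord_le (R : realType) (n : nat) (x : 'rV[R]_n) i : `|x ord0 i| <= `|x|.
Proof. by move: i; apply/rV_norm_le. Qed.

Lemma finite_net (R : realType) (n M m : nat) (A : set 'rV[R]_n) : (0 < m)%N ->
  (forall x, A x -> `|x| <= M%:R) ->
  exists s : seq 'rV[R]_n, [/\ forall p, p \in s -> A p,
    (size s <= (2 * M * m + 1) ^ n)%N &
    forall x, A x -> exists2 p, p \in s & `|x - p| <= m%:R^-1].
Proof.
move=> m0 AM.
have m0' : 0 < m%:R :> R by rewrite ltr0n.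
pose k := (2 * M * m)%N.
(* The code records the cell of side [m%:R^-1] that contains [x]. Each coordinate takes [k.+1]
   values, since the bound [M%:R] itself may be reached. *)
pose code (x : 'rV[R]_n) : {ffun 'I_n -> 'I_k.+1} :=
  [ffun i => inord (Num.truncn ((x ord0 i + M%:R) * m%:R))].
(* One point of [A] is chosen in each cell that meets [A]. The net thus lies in [A], where the
   hypotheses on the field apply. *)
pose F c := if pselect (exists x, A x /\ code x = c) is left h
  then Some (projT1 (cid h)) else None.
exists (pmap F (enum {: {ffun 'I_n -> 'I_k.+1}})); split.
- move=> p; rewrite mem_pmap => /mapP[c _]; rewrite /F.
  by case: pselect => // h [->]; case: (cid h) => /= x [].
- rewrite size_pmap (leq_trans (count_size _ _))// -cardE card_ffun !card_ord.
  by rewrite addn1.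
move=> x Ax.
have [p Fp [Ap cp]] : exists2 p, F (code x) = Some p & A p /\ code p = code x.
  rewrite /F; case: pselect => [h|]; last by case; exists x.
  by case: (cid h) => /= p [Ap cp]; exists p.
exists p; first by rewrite mem_pmap; apply/mapP; exists (code x); rewrite ?mem_enum.
apply/rV_norm_le => [|i]; first by rewrite invr_ge0.
rewrite !mxE.
have bnd y : A y -> 0 <= (y ord0 i + M%:R) * m%:R /\
    (Num.truncn ((y ord0 i + M%:R) * m%:R) <= k)%N.
  move=> /AM yM; have := le_trans (rV_coord_le y i) yM.
  rewrite ler_norml => /andP[y1 y2].
  have y0 : 0 <= (y ord0 i + M%:R) * m%:R by rewrite mulr_ge0//; lra.
  split=> //; rewrite -(ler_nat R) (@le_trans _ _ ((y ord0 i + M%:R) * m%:R))// ?truncn_le//.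
  rewrite /k !natrM ler_pM2r//; lra.
have [x0 xk] := bnd x Ax; have [p0 pk] := bnd p Ap.
have : Num.truncn ((p ord0 i + M%:R) * m%:R) = Num.truncn ((x ord0 i + M%:R) * m%:R).
  by have /ffunP/(_ i)/(congr1 val) := cp; rewrite !ffunE /= !inordK.
move=> e; have /andP[] := truncn_itv x0; have /andP[] := truncn_itv p0.
rewrite e => h1 h2 h3 h4; rewrite -natr1 in h2; rewrite -natr1 in h4.
have -> : x ord0 i - p ord0 i =
    ((x ord0 i + M%:R) * m%:R - (p ord0 i + M%:R) * m%:R) * m%:R^-1.
  by field; rewrite gt_eqF.
rewrite normrM [X in _ * X]ger0_norm ?invr_ge0// ler_piMl ?invr_ge0//.
by rewrite ler_norml; apply/andP; split; lra.
Qed.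

Lemma compact_cluster (R : realType) (n : nat) (T : set 'rV[R]_n) (u : nat -> 'rV[R]_n) :
  compact T -> (forall k, T (u k)) ->
  exists2 s, T s & forall e N, 0 < e -> exists2 k, (N <= k)%N & `|u k - s| < e.
Proof.
move=> cT Tu.
have [|s [Ts cs]] := cT (u @ \oo) _.
  by exists 0%N => // k _; exact: Tu.
exists s => // e N e0.
have h1 : (u @ \oo) [set u k | k in [set k | (N <= k)%N]].
  by exists N => // k /= Nk; exists k.
have [x [[k /= Nk <-] xs]] := cs _ _ h1 (nbhsx_ballx s e e0).
by exists k => //; move: xs; rewrite mx_norm_ball /ball_/= distrC.
Qed.

Definition continuous_on (R : realType) (n : nat) (T : set 'rV[R]_n) (g : 'rV[R]_n -> R) :=
  forall t e, T t -> 0 < e -> exists2 r, 0 < r &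
    forall s, T s -> `|s - t| < r -> `|g s - g t| < e.

Lemma C2_set_continuous_on (R : realType) (n : nat) (T : set 'rV[R]_n) (g : 'rV[R]_n -> R) :
  C2_set T g -> continuous_on T g.
Proof.
move=> [U [h [_ TU [ch _] hg]]] t e Tt e0.
have /cvgrPdist_lt/(_ e e0) := ch t (TU _ Tt).
move=> /nbhs_ballP[r r0 H]; exists r => // s Ts st.
rewrite -!hg// distrC; apply: H.
by rewrite mx_norm_ball /ball_/= distrC.
Qed.

Lemma measure_bigsetU_le (d : measure_display) (R : realType) (Y : measurableType d)
  (P : {measure set Y -> \bar R}) (I : eqType) (s : seq I) (F : I -> set Y) (c : R) :
  (forall i, i \in s -> measurable (F i)) ->
  (forall i, i \in s -> (P (F i) <= c%:E)%E) ->
  measurable (\big[setU/set0]_(i <- s) F i) /\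
  (P (\big[setU/set0]_(i <- s) F i) <= ((size s)%:R * c)%:E)%E.
Proof.
elim: s => [|i s IH] mF Fc; first by rewrite big_nil measure0 mul0r.
have [] := IH; [by move=> j js; apply: mF; rewrite in_cons js orbT|
  by move=> j js; apply: Fc; rewrite in_cons js orbT|].
move=> mU PU; have mi : measurable (F i) by apply: mF; exact: mem_head.
rewrite big_cons; split; first exact: measurableU.
apply: (le_trans (measureU2 P mi mU)).
rewrite /= -natr1 addrC mulrDl mul1r EFinD; apply: leeD => //.
by apply: Fc; exact: mem_head.
Qed.

Lemma measure_bigcup_geometric_le (d : measure_display) (R : realType) (Y : measurableType d)
  (P : {measure set Y -> \bar R}) (F : nat -> set Y) (c : R) : 0 <= c ->
  (forall k, measurable (F k)) ->
  (forall k, (P (F k) <= (c * 2^-1 ^+ k)%:E)%E) ->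
  (P (\bigcup_k F k) <= (2 * c)%:E)%E.
Proof.
move=> c0 mF Fc.
have mU : measurable (\bigcup_k F k) by exact: bigcup_measurable.
apply: (le_trans (measure_sigma_subadditive P mF mU (fun=> id))).
apply: lime_le; first by apply: is_cvg_nneseries => k _ _; exact: measure_ge0.
apply: nearW => n; apply: (@le_trans _ _ (2 * c * (1 - 2^-1 ^+ n))%:E); last first.
  rewrite lee_fin ler_piMr ?mulr_ge0// lerBlDr lerDl exprn_ge0// invr_ge0//.
elim: n => [|n IH]; first by rewrite big_geq// expr0 subrr mulr0.
rewrite big_nat_recr//=; apply: (le_trans (leeD IH (Fc n))).
by rewrite -EFinD lee_fin exprS; lra.
Qed.

(** * Chaining *)

(** The increments telescope along the chain [p], which comes arbitrarily close to [t]; continuity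
    transfers the bound to [t]. *)
Lemma chain_continuous (R : realType) (n : nat) (T : set 'rV[R]_n) (g : 'rV[R]_n -> R)
  (t : 'rV[R]_n) (p : nat -> 'rV[R]_n) (rho a : nat -> R) (e : R) :
  continuous_on T g -> T t -> (forall j, T (p j)) ->
  (forall r, 0 < r -> exists j, rho j < r) ->
  (forall j, `|t - p j| <= rho j) ->
  (forall j, g (p j.+1) - g (p j) <= a j) ->
  (forall j, \sum_(0 <= i < j) a i <= e) ->
  g t <= g (p 0) + e.
Proof.
move=> cg Tt Tp rho0 tp ga ae; apply/ler_addgt0Pr => eps eps0.
have [r r0 H] := cg t eps Tt eps0.
have [j rj] := rho0 r r0.
have hj : g (p j) <= g (p 0) + \sum_(0 <= i < j) a i.
  elim: (j) => [|k IH]; first by rewrite big_geq// addr0.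
  by rewrite big_nat_recr//=; have := ga k; lra.
have := H (p j) (Tp j); rewrite distrC (le_lt_trans (tp j) rj) => /(_ isT).
rewrite ltr_norml => /andP[h1 h2].
by have := ae j; lra.
Qed.

Section chaining.
Context {R : realType} {dO : measure_display} {Omega : measurableType dO}.
Context {P : probability Omega R} {d : nat} {T : set 'rV[R]_d}.
Context {f : 'rV[R]_d -> {RV P >-> R}}.
Hypotheses (gf : gaussian_field T f) (mz : mean_zero T f).
Variable M : nat.
Hypothesis TM : forall x, T x -> `|x| <= M%:R.
Hypothesis cf : {ae P, forall w, continuous_on T (fun t => f t w)}.
Variables (L r0 : R).
Hypotheses (L0 : 0 < L) (r00 : 0 < r0).
Hypothesis lip : forall s t, T s -> T t -> `|s - t| <= r0 -> fdist (f := f) s t <= L * `|s - t|.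

Lemma measurable_exceed (X : Omega -> R) (u : R) : measurable_fun setT X ->
  measurable [set w | u < X w].
Proof.
move=> mX; rewrite (_ : [set w | _] = X @^-1` `]u, +oo[%classic); last first.
  by apply/seteqP; split => w /=; rewrite in_itv/= andbT.
by rewrite -[Y in measurable Y]setTI; exact: mX.
Qed.

Lemma increment_tail (s t : 'rV[R]_d) (rho a : R) : T s -> T t -> 0 < rho -> rho <= r0 ->
  `|s - t| <= rho -> 0 <= a ->
  (P [set w | (a < f t w - f s w)%R] <= (expR (- (a ^+ 2 / (2 * (L * rho) ^+ 2))))%:E)%E.
Proof.
move=> Ts Tt rho0 rhor st a0.
have hle : fdist (f := f) t s <= L * rho.
  rewrite fdistC (le_trans (lip Ts Tt (le_trans st rhor)))//.
  by rewrite ler_pM2l.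
apply: centered_normal_tail_le (fdistP gf mz Tt Ts) => //.
  by rewrite exprn_gt0// mulr_gt0.
by rewrite ler_sqr ?nnegrE ?fdist_ge0// mulr_ge0// ltW.
Qed.

(** Outside an event of probability of order [expR (- (K * b ^+ 2))], with [K] at will, the field on
    [T] is dominated by its values on a finite set up to [eta * b]. The finite set does not depend
    on [b]. The proof joins each point to it through nets of dyadic mesh. *)
Lemma chaining (eta eps K : R) : 0 < eta -> 0 < eps -> 0 < K ->
  exists (s : seq 'rV[R]_d) (C b0 : R), [/\ forall p, p \in s -> T p, 0 <= C &
    forall b, b0 <= b -> exists E : set Omega, [/\ measurable E,
      (P E <= (C * expR (- (K * b ^+ 2)))%:E)%E &
      {ae P, forall w, ~ E w -> forall t, T t ->
        exists p, [/\ p \in s, `|t - p| <= eps & f t w <= f p w + eta * b]}]].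
Proof.
move=> eta0 eps0 K0.
(* The four lower bounds on [m0] serve in turn to make the first net [eps]-dense, to keep linked
   points within the range [r0] of [lip], and to make [eta * m0%:R / (8 * L)] at least 1 and at
   least [2 * K]. *)
pose m0 := (Num.truncn (Num.max (Num.max (eps^-1) (2 / r0))
  (Num.max (8 * L / eta) (16 * L * K / eta)))).+1.
have m0gt0 : 0 < m0%:R :> R by rewrite ltr0n.
have : Num.max (Num.max (eps^-1) (2 / r0)) (Num.max (8 * L / eta) (16 * L * K / eta)) < m0%:R.
  exact: truncnS_gt.
rewrite !gt_max => /andP[/andP[m1 m2] /andP[m3 m4]].
pose m j := (m0 * 2 ^ j)%N.
have m_gt0 j : (0 < m j)%N by rewrite muln_gt0/= expn_gt0.
have mE j : (m j)%:R = m0%:R * 2 ^+ j :> R by rewrite natrM natrX.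
have [N NP] := choice (fun j => finite_net (m_gt0 j) TM).
pose rho j : R := (m j)%:R^-1.
have rho_gt0 j : 0 < rho j by rewrite invr_gt0 ltr0n.
have rhoS j : rho j.+1 <= rho j.
  by rewrite lef_pV2 ?posrE ?ltr0n// ler_nat /m expnS leq_mul2l/= leq_pmull.
have rho0 : rho 0 <= eps.
  rewrite /rho mE expr0 mulr1 -[leRHS]invrK lef_pV2 ?posrE ?invr_gt0//; exact: ltW.
have rho_le j : rho j <= rho 0 by elim: j => // j; exact: le_trans.
have rho2 j : 2 * rho j <= r0.
  rewrite (@le_trans _ _ (2 * rho 0))// ?ler_pM2l// /rho mE expr0 mulr1.
  by rewrite ler_pdivrMr// mulrC -ler_pdivrMr// ltW.
pose D0 := (2 * M * m0 + 1)%N.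
(* From one level to the next each net may grow by [2 ^ d], so the number of pairs of successive
   points grows by [4 ^ d]. *)
pose Q : R := (4 ^ d)%N%:R.
have Q1 : 1 <= Q by rewrite ler1n expn_gt0.
pose C1 : R := ((D0 ^ d * D0 ^ d) * 2 ^ d)%N%:R.
have sN j : ((size (N j) * size (N j.+1))%N%:R <= C1 * Q ^+ j :> R).
  have size_le k : (size (N k) <= (D0 * 2 ^ k) ^ d)%N.
    have [_ h _] := NP k; apply: leq_trans h _.
    have [->|d0] := posnP d; first by rewrite !expn0.
    rewrite leq_exp2r// /D0 /m mulnDl mul1n mulnA leq_add2l expn_gt0//.
  rewrite /C1 /Q -natrX -natrM ler_nat.
  apply: (leq_trans (leq_mul (size_le j) (size_le j.+1))).
  rewrite -expnM (_ : 4 = 2 ^ 2)%N// -!expnM !expnMn -!expnM mulnACA -!mulnA.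
  rewrite -!expnD leq_mul// leq_mul// leq_exp2l//.
  by rewrite mulSn mulnA (mulnC j) -mulnA; lia.
(* The [a b j] sum to [eta * b], while their ratio to the scale [2 * L * rho j] of
   the increments grows like [(3 / 2) ^+ j], which beats the number of pairs. *)
pose a b j : R := eta * b / 4 * (3 / 4) ^+ j.
(* Only pairs at distance at most [2 * rho j] can be linked in a chain; the others get the empty
   event. *)
pose F b j (pq : 'rV[R]_d * 'rV[R]_d) : set Omega :=
  if `|pq.1 - pq.2| <= 2 * rho j then [set w | a b j < f pq.2 w - f pq.1 w] else set0.
pose pairs j := [seq (p, q) | p <- N j, q <- N j.+1].
pose E b := \bigcup_j \big[setU/set0]_(pq <- pairs j) F b j pq.
(* For [b] beyond this threshold [Q * expR (- (K * b ^+ 2)) <= 2^-1], so the bounds of the levels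
   form a geometric series of sum at most twice its first term. *)
exists (N 0%N), (2 * C1), (Num.max 1 (2 * Q / K)).
split; [by have [] := NP 0%N|by rewrite mulr_ge0|].
move=> b; rewrite ge_max => /andP[b1 bQ].
have b0 : 0 < b by lra.
have a0 j : 0 <= a b j by rewrite /a mulr_ge0 ?exprn_ge0 ?divr_ge0 ?mulr_ge0 ?ltW.
have FP j pq : pq \in pairs j -> measurable (F b j pq) /\
    (P (F b j pq) <= (expR (- (K * b ^+ 2 * (1 + j%:R))))%:E)%E.
  move=> /allpairsP[[p q] /= [pN qN ->]]; rewrite /F/=.
  have [Tp _ _] := NP j; have [Tq _ _] := NP j.+1.
  case: ifPn => pq_le; last by rewrite measure0 lee_fin expR_ge0; split.
  split.
    by apply: measurable_exceed; apply: measurable_funB; exact: measurable_field.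
  apply: le_trans (increment_tail (Tp _ pN) (Tq _ qN) _ (rho2 j) pq_le (a0 j)) _.
    by rewrite mulr_gt0.
  rewrite lee_fin ler_expR lerN2.
  have -> : a b j ^+ 2 / (2 * (L * (2 * rho j)) ^+ 2) =
      b ^+ 2 * (eta * m0%:R / (8 * L)) ^+ 2 / 2 * (9 / 4) ^+ j.
    rewrite /a /rho mE.
    have -> : (9 / 4 : R) ^+ j = ((3 / 4) ^+ j * 2 ^+ j) ^+ 2.
      by rewrite -exprMn exprAC; congr (_ ^+ j); field.
    have : 2 ^+ j != 0 :> R by rewrite expf_neq0.
    move: ((3 / 4 : R) ^+ j) (2 ^+ j : R) => x y y0.
    by field; rewrite y0 !gt_eqF.
  (* Growth at least linear in [j] gives a further factor [expR (- (K * b ^+ 2))] at each level,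
     which absorbs [Q]. *)
  have h94 : 1 + j%:R <= (9 / 4 : R) ^+ j.
    elim: (j) => [|i IH]; first by rewrite expr0 addr0.
    by rewrite exprS -natr1; have : 0 <= i%:R :> R by []; lra.
  have hK : K <= (eta * m0%:R / (8 * L)) ^+ 2 / 2.
    have x1 : 1 <= eta * m0%:R / (8 * L).
      rewrite ler_pdivlMr ?mulr_gt0// mul1r.
      by move: m3; rewrite ltr_pdivrMr//; lra.
    have x2 : 2 * K <= eta * m0%:R / (8 * L).
      rewrite ler_pdivlMr ?mulr_gt0//.
      by move: m4; rewrite ltr_pdivrMr// => /ltW; lra.
    by rewrite ler_pdivlMr//; nra.
  have h1 : K * b ^+ 2 * (1 + j%:R) <= K * b ^+ 2 * (9 / 4) ^+ j.
    by rewrite ler_wpM2l// mulr_ge0 ?sqr_ge0 ?ltW.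
  apply: (le_trans h1); rewrite ler_wpM2r ?exprn_ge0 ?divr_ge0//.
  by rewrite -mulrA mulrC ler_wpM2l ?sqr_ge0.
have mPairs j := @measure_bigsetU_le _ _ _ P _ (pairs j) (F b j) _
  (fun pq h => (FP j pq h).1) (fun pq h => (FP j pq h).2).
exists (E b); split.
- by apply: bigcup_measurable => j _; exact: (mPairs j).1.
- rewrite -mulrA; apply: measure_bigcup_geometric_le => [|j|j].
  + by rewrite mulr_ge0 ?expR_ge0.
  + exact: (mPairs j).1.
  apply: (le_trans (mPairs j).2); rewrite lee_fin size_allpairs.
  apply: (@le_trans _ _ (C1 * Q ^+ j * expR (- (K * b ^+ 2 * (1 + j%:R))))).
    by rewrite ler_wpM2r ?expR_ge0.
  have -> : expR (- (K * b ^+ 2 * (1 + j%:R))) =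
      expR (- (K * b ^+ 2)) * expR (- (K * b ^+ 2)) ^+ j.
    by rewrite -expRM_natl -expRD; congr expR; lra.
  set e := expR _.
  have Qe : Q * e <= 2^-1.
    rewrite /e expRN ler_pdivrMr ?expR_gt0//.
    have := expR_ge1Dx (K * b ^+ 2).
    have kb : 0 <= K * b * (b - 1) by apply: mulr_ge0; [apply: mulr_ge0; exact: ltW|lra].
    have : b * K <= K * b ^+ 2 by lra.
    by move: bQ; rewrite ler_pdivrMr//; lra.
  have : (Q * e) ^+ j <= 2^-1 ^+ j.
    by apply: lerXn2r; rewrite ?nnegrE ?mulr_ge0 ?expR_ge0// invr_ge0.
  move=> /(ler_wpM2l (_ : 0 <= C1 * e)); rewrite mulr_ge0 ?expR_ge0// => /(_ isT).
  by apply: le_trans; rewrite exprMn le_eqVlt; apply/orP; left; apply/eqP; ring.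
apply: filterS cf => w cw nE t Tt.
have [p pP] : {p : nat -> 'rV[R]_d & forall j, p j \in N j /\ `|t - p j| <= rho j}.
  apply: (@choice _ _ (fun j p => p \in N j /\ `|t - p| <= rho j)) => j.
  by have [_ _ /(_ t Tt)[p pN tp]] := NP j; exists p.
exists (p 0%N); split; [exact: (pP 0%N).1|exact: le_trans (pP 0%N).2 _|].
apply: (chain_continuous (rho := rho) (a := a b) cw Tt) => //.
- by move=> j; have [Tp _ _] := NP j; apply: Tp; exact: (pP j).1.
- move=> r r_gt0; exists (Num.truncn r^-1).
  rewrite /rho -[ltRHS]invrK ltf_pV2 ?posrE ?invr_gt0 ?ltr0n//.
  apply: (lt_le_trans (truncnS_gt _)); rewrite ler_nat.
  by rewrite (leq_trans (ltn_expl _ (ltnSn 1)))// /m leq_pmull.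
- by move=> j; exact: (pP j).2.
(* A link with too large an increment would put [w] in [E b]: its ends are at distance at most
   [rho j + rho j.+1] from each other. *)
- move=> j; rewrite leNgt; apply/negP => lt.
  apply: nE; exists j => //; rewrite -bigcup_seq; exists (p j, p j.+1) => /=.
    by apply/allpairsP; exists (p j, p j.+1); split=> //=; exact: (pP _).1.
  rewrite /F/= ifT//; have := ler_normD (p j - t) (t - p j.+1).
  rewrite addrA subrK => h; apply: (le_trans h); rewrite distrC.
  by have := (pP j).2; have := (pP j.+1).2; have := rhoS j; lra.
- move=> j; rewrite -mulr_sumr.
  have : \sum_(0 <= i < j) (3 / 4 : R) ^+ i = 4 * (1 - (3 / 4) ^+ j).
    elim: j => [|j IH]; first by rewrite big_geq// expr0 subrr mulr0.
    by rewrite big_nat_recr//= IH exprS; lra.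
  move=> ->; have x0 : 0 <= (3 / 4 : R) ^+ j by rewrite exprn_ge0.
  by rewrite mulrA divfK// ler_piMr ?mulr_ge0 ?ltW// lerBlDr lerDl.
Qed.

End chaining.

(** * Lipschitz bound from differentiability of the paths *)

Section ae_measure.
Context {R : realType} {dO : measure_display} {Omega : measurableType dO}.
Variable P : probability Omega R.

Lemma ae_le_measure (A B : set Omega) : measurable A -> measurable B ->
  {ae P, forall w, A w -> B w} -> (P A <= P B)%E.
Proof.
move=> mA mB [N [mN N0 AB]].
apply: (@le_trans _ _ (P (B `|` N))).
  apply: le_measure; rewrite ?inE//; first exact: measurableU.
  move=> w Aw; have [Bw|nBw] := pselect (B w); [by left|right].
  by apply: AB => /= /(_ Aw).
by apply: (le_trans (measureU2 P mB mN)); rewrite [X in (_ + X)%E]N0 adde0.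
Qed.

Lemma ae_all_seq (I : eqType) (s : seq I) (Q : I -> Omega -> Prop) :
  (forall i, i \in s -> {ae P, forall w, Q i w}) ->
  {ae P, forall w, forall i, i \in s -> Q i w}.
Proof.
elim: s => [|i s IH] H; first by apply: aeW => w i; rewrite in_nil.
have h1 := H i (mem_head _ _).
have h2 : {ae P, forall w, forall i, i \in s -> Q i w}.
  by apply: IH => j js; apply: H; rewrite in_cons js orbT.
by apply: filterS2 h1 h2 => w Qi Qs j; rewrite in_cons => /predU1P[->|/Qs].
Qed.

End ae_measure.

Section lipschitz.
Context {R : realType} {dO : measure_display} {Omega : measurableType dO}.
Context {P : probability Omega R} {d : nat} {T : set 'rV[R]_d}.
Context {f : 'rV[R]_d -> {RV P >-> R}}.
Hypotheses (gf : gaussian_field T f) (mz : mean_zero T f) (hom : homogeneous T f).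
Hypothesis C2f : {ae P, forall w, C2_set T (fun t => f t w)}.
Variables (c : 'rV[R]_d) (r1 : R).
Hypotheses (r10 : 0 < r1) (cT : forall x, `|x - c| <= r1 -> T x).
Local Notation D := (fdist (f := f)).
Local Notation e_ i := (delta_mx ord0 i : 'rV[R]_d).

Lemma centre_in : T c.
Proof. by apply: cT; rewrite subrr normr0 ltW. Qed.

Lemma centreD_in (x : 'rV[R]_d) : `|x| <= r1 -> T (c + x).
Proof. by move=> x1; apply: cT; rewrite addrAC subrr add0r. Qed.

Lemma norm_scale_delta (h : R) i : `|h *: e_ i| <= `|h|.
Proof.
apply/rV_norm_le => // j; rewrite !mxE eqxx/=.
by case: eqP => _; rewrite ?mulr1// mulr0 normr0.
Qed.

(** The difference quotient converges to a partial derivative of the extension. The same [m] bounds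
    the quotient and restricts [h], so that one integer indexes an increasing sequence of events. *)
Lemma C2_set_quotient_bounded (g : 'rV[R]_d -> R) i : C2_set T g ->
  exists (m : nat), forall h, 0 < h -> h < m.+1%:R^-1 -> h <= r1 ->
    g (c + h *: e_ i) - g c <= m%:R * h.
Proof.
move=> [U [k [_ TU [_ Ck] kg]]].
have [/(_ c (TU _ centre_in)) /cvg_ex[/= l]] := Ck i.
move=> /cvgrPdist_lt/(_ 1 ltr01).
move=> /nbhs_ballP[r r0 H] _.
exists (Num.truncn (Num.max r^-1 (`|l| + 1))).+1 => h h0 hm hr.
have := truncnS_gt (Num.max r^-1 (`|l| + 1)).
set m := (Num.truncn _).+1 in hm *; rewrite gt_max => /andP[mr ml].
have hr' : h < r.
  apply: (lt_le_trans hm); rewrite invf_ple ?posrE// ltW//.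
  by rewrite (lt_trans mr)// ltr_nat.
have /H : ball (0 : R) r h by rewrite /ball/= sub0r normrN gtr0_norm.
move=> /(_ (lt0r_neq0 h0)).
rewrite !kg; [|exact: centre_in|]; last first.
  rewrite addrC; apply: centreD_in; apply: le_trans (norm_scale_delta _ _) _.
  by rewrite gtr0_norm.
rewrite distrC => /(le_lt_trans (lerB_dist _ _)).
rewrite ltrBlDr normrZ gtr0_norm ?invr_gt0// => q.
apply: (le_trans (ler_norm _)); rewrite [c + _]addrC -ler_pdivrMr// mulrC ltW//.
by rewrite (lt_trans q)// addrC.
Qed.

(** Otherwise some [h n < n.+1%:R^-1] have [D (c + h n *: e_ i) c > n%:R * h n]. The increments over
    [h n] then have scales too large for the difference quotients to be almost surely bounded. *)
Lemma fdist_direction_le i :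
  exists L r, [/\ 0 < L, 0 < r, r <= r1 &
    forall h, 0 < h -> h <= r -> D (c + h *: e_ i) c <= L * h].
Proof.
apply: contrapT => no.
have no' (n : nat) : exists h, [/\ 0 < h, h < n.+1%:R^-1, h <= r1 & n%:R * h < D (c + h *: e_ i) c].
  apply: contrapT => no'; apply: no.
  exists n.+1%:R, (Num.min r1 (n.+2%:R^-1)); split; rewrite ?ltr0n//.
  - by rewrite lt_min r10 invr_gt0 ltr0n.
  - by rewrite ge_min lexx.
  move=> h h0; rewrite le_min => /andP[hr hn]; rewrite leNgt; apply/negP => lt.
  apply: no'; exists h; split=> //.
    by apply: (le_lt_trans hn); rewrite ltf_pV2 ?posrE ?ltr0n// ltr_nat.
  by apply: le_lt_trans lt; rewrite ler_pM2r// ler_nat.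
have [h hP] := choice no'.
pose X n w := f (c + h n *: e_ i) w - f c w.
have Tn n : T (c + h n *: e_ i).
  have [h0 _ hr _] := hP n; apply: centreD_in.
  by apply: le_trans (norm_scale_delta _ _) _; rewrite gtr0_norm.
have XP n : centered_normal P (X n) (D (c + h n *: e_ i) c).
  by rewrite /X; have := fdistP gf mz (Tn n) centre_in.
have mX n : measurable_fun setT (X n) by apply: measurable_funB; exact: measurable_field.
(* On [A m] the difference quotients are at most [m] from index [m] on. Differentiability makes the
   union of these increasing events almost sure. *)
pose A m := \bigcap_(n in [set n | (m <= n)%N]) ~` [set w | m%:R * h n < X n w].
have mA m : measurable (A m).
  by apply: bigcap_measurableType => n _; apply: measurableC; exact: measurable_exceed.
have ndA : nondecreasing_seq A.
  move=> m m' mm'; apply/subsetPset => w Aw n /= mn; have := Aw n (leq_trans mm' mn).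
  apply: contra_not => /=; apply: le_lt_trans.
  by rewrite ler_wpM2r ?ler_nat//; have [/ltW] := hP n.
have mUA : measurable (\bigcup_m A m) by exact: bigcup_measurable.
have UA1 : (1 <= P (\bigcup_m A m))%E.
  rewrite -(probability_setT P); apply: ae_le_measure => //.
  apply: filterS C2f => w C2w _.
  have [m H] := C2_set_quotient_bounded i C2w.
  exists m => // n /= mn; apply/negP; rewrite -leNgt /X.
  have [h0 hn hr _] := hP n.
  by apply: H => //; apply: (lt_le_trans hn); rewrite lef_pV2 ?posrE ?ltr0n// ler_nat.
have [c0 c00 tail] := centered_normal_tail_ge P.
(* A centred normal variable exceeds its own scale with probability at least [q], whatever the
   scale. The scale of [X m] is above [m%:R * h m], so [A m] misses an event of probability at least
   [q]. *)
pose q := c0 * expR (- 2^-1).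
have q0 : 0 < q by rewrite mulr_gt0 ?expR_gt0.
have PA m : (P (A m) <= (1 - q)%:E)%E.
  have [h0 _ _ sm] := hP m.
  have s0 : 0 < D (c + h m *: e_ i) c by apply: le_lt_trans sm; rewrite mulr_ge0// ltW.
  have := tail _ _ _ s0 (lexx _) (XP m).
  have -> : c0 * D (c + h m *: e_ i) c / D (c + h m *: e_ i) c = c0.
    by rewrite mulfK// gt_eqF.
  have -> : D (c + h m *: e_ i) c ^+ 2 / (2 * D (c + h m *: e_ i) c ^+ 2) = 2^-1.
    by field; rewrite gt_eqF.
  move=> ht.
  have mB : measurable [set w | D (c + h m *: e_ i) c < X m w] by exact: measurable_exceed.
  apply: (@le_trans _ _ (P (~` [set w | D (c + h m *: e_ i) c < X m w]))).
    apply: le_measure; rewrite ?inE//; first exact: measurableC.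
    move=> w /(_ m) /= /(_ (leqnn m)); apply: contra_not; exact: lt_trans.
  by rewrite probability_setC// EFinB leeB.
have : (P (\bigcup_m A m) <= (1 - q)%:E)%E.
  have h0 : P (A m) @[m --> \oo] --> P (\bigcup_m A m).
    exact: nondecreasing_cvg_mu.
  rewrite -(cvg_lim _ h0)//; apply: lime_le; last exact: nearW.
  by apply/cvg_ex; exists (P (\bigcup_m A m)).
by move=> /(le_trans UA1); rewrite lee_fin; lra.
Qed.

(** A displacement is split into moves along the axes, each translated to start at [c]; a general
    pair is translated so that [t] falls on [c]. *)
Lemma fdist_lipschitz : exists L r0, [/\ 0 < L, 0 < r0 &
  forall s t, T s -> T t -> `|s - t| <= r0 -> D s t <= L * `|s - t|].
Proof.
have [L LP] := choice fdist_direction_le.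
have [r rP] := choice LP.
pose L1 := \sum_i L i + 1.
have L_ge0 i : 0 <= L i by have [/ltW] := rP i.
have L10 : 0 < L1 by rewrite ltr_wpDl// sumr_ge0.
have LL1 i : L i <= L1.
  by rewrite /L1 (bigD1 i)//= -addrA lerDl addr_ge0// sumr_ge0.
pose r0 := \big[Num.min/r1]_i r i.
have r00 : 0 < r0 by apply/bigmin_gtP; split => // i _; have [] := rP i.
have r0r1 : r0 <= r1 by exact: bigmin_le_id.
have r0r i : r0 <= r i by exact: bigmin_le.
have dir i h : 0 <= h -> h <= r0 -> D (c + h *: e_ i) c <= L1 * h.
  rewrite le_eqVlt => /predU1P[<-|h0 hr].
    by rewrite scale0r addr0 fdistxx mulr0.
  have [_ _ _ H] := rP i; apply: (le_trans (H h h0 (le_trans hr (r0r i)))).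
  by rewrite ler_pM2r.
(* The displacement with only the first [k] coordinates of [x] carried out. *)
pose part (x : 'rV[R]_d) k : 'rV[R]_d := \row_i (if (i < k)%N then x ord0 i else 0).
have part_le x k : `|part x k| <= `|x|.
  apply/rV_norm_le => // i; rewrite mxE; case: ifP => _; first exact: rV_coord_le.
  by rewrite normr0.
have step x k : (k <= d)%N -> `|x| <= r0 -> D (c + part x k) c <= k%:R * L1 * `|x|.
  elim: k => [|k IH] kd xr.
    rewrite (_ : part x 0 = 0) ?addr0 ?fdistxx ?mul0r//.
    by apply/rowP => i; rewrite !mxE.
  have Tp j : T (c + part x j) by apply: centreD_in; rewrite (le_trans (part_le _ _))// (le_trans xr).
  apply: (le_trans (fdist_triangle gf mz (Tp k.+1) (Tp k) centre_in)).
  rewrite -natr1 addrC 2!mulrDl mul1r; apply: lerD; first exact: IH (ltnW kd) xr.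
  pose i := Ordinal kd; pose h := x ord0 i.
  have hx : `|h| <= `|x| by exact: rV_coord_le.
  have partS : part x k.+1 = part x k + h *: e_ i.
    apply/rowP => j; rewrite !mxE eqxx/= ltnS leq_eqVlt.
    have [->|ji] := eqVneq j i; first by rewrite eqxx/= ltnn mulr1 add0r.
    by rewrite -(inj_eq val_inj) /= in ji; rewrite (negbTE ji) mulr0 addr0.
  have Te y : `|y| <= `|x| -> T (c + y *: e_ i).
    move=> yx; apply: centreD_in; apply: (le_trans (norm_scale_delta _ _)).
    by rewrite (le_trans yx)// (le_trans xr).
  have [h0|h0] := leP 0 h.
    have := @fdist_translate _ _ _ _ _ _ _ gf mz hom (part x k) (c + h *: e_ i) c
      (Te _ hx) centre_in.
    rewrite -addrA [h *: _ + _]addrC -partS => /(_ (Tp _) (Tp _)) ->.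
    rewrite (le_trans (dir i h h0 _))//; first by rewrite (le_trans (ler_norm _))// (le_trans hx).
    by rewrite ler_pM2l// (le_trans (ler_norm _)).
  (* Only nonnegative moves are covered by [dir], so a negative one is read backwards. *)
  have hN : part x k = part x k.+1 + (- h) *: e_ i by rewrite partS scaleNr addrK.
  have hNx : `|- h| <= `|x| by rewrite normrN.
  have := @fdist_translate _ _ _ _ _ _ _ gf mz hom (part x k.+1) (c + (- h) *: e_ i) c
    (Te _ hNx) centre_in.
  rewrite -addrA [(- h) *: _ + _]addrC -hN => /(_ (Tp _) (Tp _)).
  rewrite fdistC => ->.
  have h0' : 0 <= - h by lra.
  rewrite (le_trans (dir i _ h0' _))//; first by rewrite (le_trans (ler_norm _))// (le_trans hNx).
  by rewrite ler_pM2l// (le_trans (ler_norm _)).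
(* The factor [d.+1] instead of [d] keeps the constant positive when [d = 0]. *)
exists (d.+1%:R * L1), r0; split => //; first by rewrite mulr_gt0 ?ltr0n.
move=> s t Ts Tt st.
have Tst : T (c + (s - t)) by apply: centreD_in; exact: le_trans r0r1.
have := @fdist_translate _ _ _ _ _ _ _ gf mz hom (t - c) (c + (s - t)) c Tst centre_in.
have -> : c + (s - t) + (t - c) = s by rewrite addrC addrA subrK addrC subrK.
have -> : c + (t - c) = t by rewrite addrC subrK.
move=> /(_ Ts Tt) ->.
have := step (s - t) d (leqnn d) st.
rewrite (_ : part _ _ = s - t); last by apply/rowP => i; rewrite !mxE ltn_ord.
move=> /le_trans; apply; rewrite ler_wpM2r// ler_pM2r// ler_nat//.
Qed.

End lipschitz.

(** * Lower bound from uniqueness of the maximum *)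

Section nondegenerate.
Context {R : realType} {dO : measure_display} {Omega : measurableType dO}.
Context {P : probability Omega R} {d : nat} {T : set 'rV[R]_d}.
Context {f : 'rV[R]_d -> {RV P >-> R}}.
Hypotheses (gf : gaussian_field T f) (mz : mean_zero T f) (hom : homogeneous T f).
Hypothesis (T0 : T 0).
Hypothesis var0 : (0 < 'V_P[f 0])%E.
Hypothesis compT : compact T.
Variable M : nat.
Hypothesis TM : forall x, T x -> `|x| <= M%:R.
Hypothesis cf : {ae P, forall w, continuous_on T (fun t => f t w)}.
Hypothesis uf : unique_global_max T f.
Variables (L r0 : R).
Hypotheses (L0 : 0 < L) (r00 : 0 < r0).
Hypothesis lip : forall s t, T s -> T t -> `|s - t| <= r0 ->
  fdist (f := f) s t <= L * `|s - t|.
Variables (c : 'rV[R]_d) (r1 : R).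
Hypotheses (r10 : 0 < r1) (cT : forall x, `|x - c| <= r1 -> T x).
Local Notation D := (fdist (f := f)).
Local Notation sigma := (fscale (f := f)).

Let Tc : T c. Proof. exact: centre_in r10 cT. Qed.

(** For one pair the equality is almost sure. Countably many pairs, dense among those with
    [D s t = 0], are treated at once, and continuity gives the rest. *)
Lemma fdist0_all_ae :
  {ae P, forall w, forall s t, T s -> T t -> D s t = 0 -> f s w = f t w}.
Proof.
(* Pairs are encoded as rows of length [d + d] so that [finite_net] yields nets inside the set of
   pairs at [D]-distance 0. *)
pose A : set 'rV[R]_(d + d) :=
  [set x | [/\ T (lsubmx x), T (rsubmx x) & D (lsubmx x) (rsubmx x) = 0]].
have AM x : A x -> `|x| <= M%:R.
  move=> [/TM xl /TM xr _]; apply/rV_norm_le => // i.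
  rewrite -[x]hsubmxK mxE; case: splitP => j _.
    exact: le_trans (rV_coord_le _ _) xl.
  exact: le_trans (rV_coord_le _ _) xr.
have [N NP] := choice (fun m => finite_net (ltn0Sn m) AM).
have : {ae P, forall w, forall m, forall p, p \in N m ->
    f (lsubmx p) w = f (rsubmx p) w}.
  apply: ae_foralln => m; apply: ae_all_seq => p pN.
  have [/(_ p pN)[Tl Tr D0] _ _] := NP m.
  exact: filterS (fdist0_ae gf mz Tl Tr D0).
apply: filterS2 cf => w cw H s t Ts Tt st0.
apply/eqP; rewrite -subr_eq0 -normr_le0; apply/ler_addgt0Pr => e e0; rewrite add0r.
have e20 : 0 < e / 2 by rewrite divr_gt0.
have [r r_gt0 hr] := cw s _ Ts e20; have [r' r'0 hr'] := cw t _ Tt e20.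
pose m := Num.truncn (Num.max r^-1 r'^-1).
have := truncnS_gt (Num.max r^-1 r'^-1); rewrite -/m gt_max => /andP[m1 m2].
have Ax : A (row_mx s t) by split; rewrite ?row_mxKl ?row_mxKr.
have [_ _ /(_ _ Ax)[p pN xp]] := NP m.
have [/(_ p pN)[Tl Tr _] _ _] := NP m.
have lt1 r2 : 0 < r2 -> r2^-1 < m.+1%:R -> m.+1%:R^-1 < r2 :> R.
  by move=> r20 h; rewrite -[ltRHS]invrK ltf_pV2 ?posrE ?invr_gt0 ?ltr0n.
have close1 : `|lsubmx p - s| < r.
  apply: le_lt_trans (lt1 r r_gt0 m1); apply/rV_norm_le; first by rewrite invr_ge0.
  move=> i; apply: le_trans xp.
  have := rV_coord_le (row_mx s t - p) (lshift d i).
  by rewrite !mxE (unsplitK (inl i)) distrC.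
have close2 : `|rsubmx p - t| < r'.
  apply: le_lt_trans (lt1 r' r'0 m2); apply/rV_norm_le; first by rewrite invr_ge0.
  move=> i; apply: le_trans xp.
  have := rV_coord_le (row_mx s t - p) (rshift d i).
  by rewrite !mxE (unsplitK (inr i)) distrC.
have := hr _ Tl close1; have := hr' _ Tr close2.
rewrite (H m p pN) !ltr_norml ler_norml => /andP[? ?] /andP[? ?].
by apply/andP; split; lra.
Qed.

(** The condition is deterministic: it confines the random maximizer to a fixed subset of [T]. *)
Definition isolated t := T t /\ forall s, T s -> D t s = 0 -> s = t.

(** A point at [D]-distance 0 from the maximizer has the same value, hence is a maximizer too, and
    uniqueness identifies them. *)
Lemma argmax_isolated_ae : {ae P, forall w, exists2 t, isolated t &
  forall s, T s -> f s w <= f t w}.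
Proof.
apply: filterS2 uf fdist0_all_ae => w [t [[Tt tmax] tuniq]] H; exists t => //.
split=> // s Ts ts0; apply/esym/tuniq; split => // u Tu.
by rewrite -(H t s)//; exact: tmax.
Qed.

Lemma isolated_near (delta : R) : 0 < delta -> exists2 t, isolated t & D c t < delta.
Proof.
wlog : delta / delta <= sigma.
  move=> H delta0; have s0 : 0 < sigma by exact: fscale_gt0 gf mz hom T0 var0.
  have [] := H (Num.min delta sigma); first by rewrite ge_min lexx orbT.
    by rewrite lt_min delta0.
  by move=> t it; rewrite lt_min => /andP[ct _]; exists t.
move=> delta_s delta0; apply: contrapT => no.
have far t : isolated t -> delta <= D c t.
  by move=> it; rewrite leNgt; apply/negP => lt; apply: no; exists t.
have s0 : 0 < sigma by exact: fscale_gt0 gf mz hom T0 var0.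
(* If [D c p >= delta / 2], the variance of [f c + f p] is at most [4 * sigma ^+ 2 * (1 - rh)]. The
   reduction to [delta <= sigma] keeps [rh] small. *)
pose rh := delta ^+ 2 / (16 * sigma ^+ 2).
have rh0 : 0 < rh by rewrite divr_gt0 ?mulr_gt0 ?exprn_gt0.
have rhE : delta ^+ 2 = rh * 16 * sigma ^+ 2.
  by rewrite /rh; field; rewrite gt_eqF.
have rh1 : rh <= 16^-1.
  rewrite /rh ler_pdivrMr ?mulr_gt0 ?exprn_gt0// mulrA mulVf// mul1r.
  by rewrite ler_sqr ?nnegrE//; exact: ltW.
(* This exceeds the rate [1 / (2 * sigma ^+ 2)] of the tail of [f c]. It is reached by
   [f c + f p > (2 - rh / 2) * b] since [(2 - rh / 2) ^+ 2 >= 4 * (1 + rh / 2) * (1 - rh)]. *)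
pose K := (1 + rh / 2) / (2 * sigma ^+ 2).
have K0 : 0 < K by rewrite divr_gt0 ?mulr_gt0 ?exprn_gt0//; lra.
(* Replacing [t] by a point within [eps] changes the [D]-distance to [c] by at most [delta / 2]. *)
pose eps := Num.min r0 (delta / (2 * L)).
have eps0 : 0 < eps by rewrite lt_min r00 divr_gt0 ?mulr_gt0.
have eta0 : 0 < rh / 2 by lra.
have [net [C [b0 [netT C0 chain]]]] := chaining gf mz TM cf L0 r00 lip eta0 eps0 K0.
have [c0 c00 tail] := centered_normal_tail_ge P.
pose C' : R := C + (size net)%:R.
have C'0 : 0 <= C' by rewrite addr_ge0.
pose k := rh / (4 * sigma ^+ 2).
have k0 : 0 < k by apply: divr_gt0 => //; rewrite mulr_gt0 ?exprn_gt0.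
(* The upper and lower bounds of [P (f c > b)] differ by a factor [expR (k * b ^+ 2)], up to a power
   of [b]. This leaves an inequality that fails for large [b]. *)
have main b : b0 <= b -> sigma <= b -> c0 * sigma * k * b <= C'.
  move=> bb0 bs; have b_gt0 : 0 < b by exact: lt_le_trans bs.
  have [E [mE PE aeE]] := chain b bb0.
  pose G p : set Omega := if delta / 2 <= D c p
    then [set w | (2 - rh / 2) * b < f c w + f p w] else set0.
  have mG p : p \in net -> measurable (G p).
    move=> _; rewrite /G; case: ifP => // _.
    by apply: measurable_exceed; apply: measurable_funD; exact: measurable_field.
  have PG p : p \in net -> (P (G p) <= (expR (- (K * b ^+ 2)))%:E)%E.
    move=> pn; rewrite /G; case: ifPn => [cp|_]; last by rewrite measure0 lee_fin expR_ge0.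
    have v0 : 0 < 4 * sigma ^+ 2 * (1 - rh).
      by rewrite mulr_gt0 ?mulr_gt0 ?exprn_gt0//; lra.
    apply: (le_trans (centered_normal_tail_le _ v0 _ (fsumP gf mz Tc (netT _ pn)))).
    - by rewrite mulr_ge0 ?(ltW b_gt0)//; lra.
    - rewrite (fsum_sqr gf mz hom T0 Tc (netT _ pn)).
      have : (delta / 2) ^+ 2 <= D c p ^+ 2.
        by rewrite ler_sqr ?nnegrE ?fdist_ge0// divr_ge0// ltW.
      rewrite expr_div_n rhE; lra.
    rewrite lee_fin ler_expR lerN2 /K exprMn.
    have w0 : 0 < 2 * (4 * sigma ^+ 2 * (1 - rh)) by apply: mulr_gt0.
    rewrite ler_pdivlMr//.
    rewrite [leLHS](_ : _ = (1 + rh / 2) * (1 - rh) * 4 * b ^+ 2); last first.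
      by field; rewrite gt_eqF.
    by rewrite ler_wpM2r ?sqr_ge0//; nra.
  have [mU PU] := measure_bigsetU_le mG PG.
  have le1 : (P [set w | (b < f c w)%R] <= (C' * expR (- (K * b ^+ 2)))%:E)%E.
    apply: (@le_trans _ _ (P (E `|` \big[setU/set0]_(p <- net) G p))).
      apply: ae_le_measure.
      - by apply: measurable_exceed; exact: measurable_field.
      - exact: measurableU.
      (* If [f c > b], the maximizer [t] is far from [c] for [D] with [f t > b]; off [E] a net point
         [p] near [t] is still far from [c] and has [f p > (1 - rh / 2) * b]. *)
      apply: filterS2 aeE argmax_isolated_ae => w aw [t it tmax] /= bfc.
      have [Ew|nE] := pselect (E w); [by left|right].
      have Tt := it.1.
      have [p [pn tp ftp]] := aw nE t Tt.
      rewrite -bigcup_seq; exists p => //.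
      have Tp := netT _ pn.
      have := tmax c Tc; have := far t it.
      have := fdist_triangle gf mz Tc Tp Tt.
      move: tp; rewrite /eps le_min => /andP[tp1 tp2].
      have := lip Tt Tp tp1; rewrite fdistC.
      have : L * `|t - p| <= delta / 2.
        by move: tp2; rewrite -(ler_pM2l L0); congr (_ <= _); field; rewrite gt_eqF.
      rewrite /G => *; rewrite ifT /=; nra.
    apply: (le_trans (measureU2 P mE mU)).
    by rewrite /C' mulrDl EFinD; apply: leeD.
  have := le_trans (tail _ _ _ s0 bs (fscaleP gf mz hom T0 Tc)) le1.
  rewrite lee_fin => h.
  have e1 : expR (- (K * b ^+ 2)) = expR (- (b ^+ 2 / (2 * sigma ^+ 2))) * expR (- (k * b ^+ 2)).
    by rewrite -expRD; congr expR; rewrite /K /k; field; rewrite gt_eqF.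
  move: h; rewrite e1 (mulrCA C') [leLHS]mulrC ler_pM2l ?expR_gt0// expRN.
  rewrite ler_pdivlMr ?expR_gt0// => h.
  apply: le_trans h.
  have ek : k * b ^+ 2 <= expR (k * b ^+ 2).
    by apply: le_trans (expR_ge1Dx _); lra.
  apply: (@le_trans _ _ (c0 * sigma / b * (k * b ^+ 2))).
    by rewrite le_eqVlt; apply/orP; left; apply/eqP; field; rewrite gt_eqF.
  by rewrite ler_pM2l// divr_gt0 ?mulr_gt0.
have q0 : 0 < c0 * sigma * k by apply: mulr_gt0 => //; exact: mulr_gt0.
have := main (Num.max (Num.max b0 sigma) ((C' + 1) / (c0 * sigma * k))).
rewrite !le_max !lexx/= orbT => /(_ isT isT).
apply/negP; rewrite -ltNge.
apply: (@lt_le_trans _ _ (c0 * sigma * k * ((C' + 1) / (c0 * sigma * k)))).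
  by rewrite mulrC divfK ?gt_eqF// ltrDl.
by rewrite ler_pM2l// le_max lexx orbT.
Qed.

Lemma fdist_gt0 (tau : 'rV[R]_d) : `|tau| <= r1 / 2 -> tau != 0 -> 0 < D (c + tau) c.
Proof.
move=> tau1 tau0; rewrite lt_neqAle fdist_ge0 andbT eq_sym; apply/eqP => Dtau.
have [u uP] : {u : nat -> 'rV[R]_d & forall n, isolated (u n) /\ D c (u n) < n.+1%:R^-1}.
  apply: (@choice _ _ (fun n t => isolated t /\ D c t < n.+1%:R^-1)) => n.
  have [|t it ct] := @isolated_near n.+1%:R^-1; first by rewrite invr_gt0.
  by exists t.
have Tu n : T (u n) by have [[]] := uP n.
have [s Ts sP] := compact_cluster compT Tu.
have Dcs : D c s = 0.
  apply/eqP; rewrite eq_le fdist_ge0 andbT; apply/ler_addgt0Pr => e e0; rewrite add0r.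
  have e1 : 0 < Num.min r0 (e / (2 * L)) by rewrite lt_min r00 divr_gt0 ?mulr_gt0.
  have [n nN] := sP _ (Num.truncn (2 / e)) e1.
  rewrite lt_min => /andP[us1 us2].
  have [_ cu] := uP n.
  have h1 := lip (Tu n) Ts (ltW us1).
  have h2 : L * `|u n - s| <= e / 2.
    have := ltW us2; rewrite -(ler_pM2l L0); congr (_ <= _); field.
    by rewrite gt_eqF.
  have h3 : n.+1%:R^-1 <= e / 2.
    rewrite -[leRHS]invrK lef_pV2 ?posrE ?invr_gt0 ?divr_gt0// invf_div.
    by apply: (le_trans (ltW (truncnS_gt _))); rewrite ler_nat.
  apply: (le_trans (fdist_triangle gf mz Tc (Tu n) Ts)).
  rewrite [leRHS]splitr lerD//; first exact: le_trans (ltW cu) h3.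
  exact: le_trans h1 h2.
have r12 : 0 < r1 / 2 by rewrite divr_gt0.
have [n _ un] := sP _ 0%N r12.
have [[_ isou] _] := uP n.
have Tq : T (c + (u n - s)).
  by apply: (centreD_in cT); rewrite (le_trans (ltW un))//; lra.
(* Translation by [u n - s] carries [s] to [u n] and [c] to [c + (u n - s)]. These are at
   [D]-distance 0, and [u n] is isolated. *)
have sc : c = s.
  have := isou _ Tq.
  have := @fdist_translate _ _ _ _ _ _ _ gf mz hom (u n - s) s c Ts Tc.
  rewrite [s + _]addrC subrK => /(_ (Tu n) Tq) ->.
  rewrite fdistC Dcs => /(_ erefl) /eqP.
  by rewrite addrCA -subr_eq0 addrAC subrr add0r subr_eq0 => /eqP.
have Tt : T (u n + tau).
  apply: cT; rewrite addrAC (le_trans (ler_normD _ _))// sc.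
  by have := ltW un; lra.
have Tct : T (c + tau) by apply: (centreD_in cT); rewrite (le_trans tau1)//; lra.
have := isou _ Tt.
have := @fdist_translate _ _ _ _ _ _ _ gf mz hom (u n - c) (c + tau) c Tct Tc.
have -> : c + (u n - c) = u n by rewrite addrC subrK.
have -> : c + tau + (u n - c) = u n + tau by rewrite addrC addrA subrK.
move=> /(_ Tt (Tu n)); rewrite fdistC => ->.
rewrite Dtau => /(_ erefl) /eqP.
by rewrite -subr_eq0 addrAC subrr add0r (negbTE tau0).
Qed.

(** By compactness [D (c + tau) c] is bounded below on a shell. A small [tau] has a multiple in the
    shell, and [D] grows at most linearly along multiples. *)
Lemma fdist_coercive : exists2 kappa, 0 < kappa &
  forall tau : 'rV[R]_d, `|tau| <= r1 / 2 -> kappa * `|tau| <= D (c + tau) c.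
Proof.
pose r2 := r1 / 2.
have r20 : 0 < r2 by rewrite divr_gt0.
have r21 : r2 <= r1 by rewrite /r2 ler_pdivrMr// mulr_natr mulr2n lerDl ltW.
have Tt (tau : 'rV[R]_d) : `|tau| <= r2 -> T (c + tau).
  by move=> h; apply: (centreD_in cT); exact: le_trans r21.
have [k0 k00 shell] : exists2 k0, 0 < k0 & forall tau : 'rV[R]_d,
    r2 / 2 <= `|tau| -> `|tau| <= r2 -> k0 <= D (c + tau) c.
  apply: contrapT => no.
  have no' (n : nat) : exists tau : 'rV[R]_d,
      [/\ r2 / 2 <= `|tau|, `|tau| <= r2 & D (c + tau) c < n.+1%:R^-1].
    apply: contrapT => no'; apply: no; exists n.+1%:R^-1; first by rewrite invr_gt0.
    by move=> tau h1 h2; rewrite leNgt; apply/negP => lt; apply: no'; exists tau.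
  have [u uP] := choice no'.
  have Tu n : T (c + u n) by have [_ h _] := uP n; exact: Tt.
  have [s Ts sP] := compact_cluster compT Tu.
  have lim e : 0 < e -> exists n, [/\ `|c + u n - s| < e & D (c + u n) c < e].
    move=> e0; have [n nN us] := sP e (Num.truncn e^-1) e0; exists n; split=> //.
    have [_ _ h] := uP n; apply: (lt_le_trans h).
    rewrite -[leRHS]invrK lef_pV2 ?posrE ?invr_gt0//.
    by apply: (le_trans (ltW (truncnS_gt _))); rewrite ler_nat.
  have Dsc : D s c = 0.
    apply/eqP; rewrite eq_le fdist_ge0 andbT; apply/ler_addgt0Pr => e e0; rewrite add0r.
    have [|n [us Du]] := lim (Num.min (Num.min r0 (e / (2 * L))) (e / 2)).
      by rewrite !lt_min r00 !divr_gt0 ?mulr_gt0.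
    move: us Du; rewrite !lt_min => /andP[/andP[us1 us2] _] /andP[_ Du].
    have h1 := lip (Tu n) Ts (ltW us1).
    have h2 : L * `|c + u n - s| <= e / 2.
      have := ltW us2; rewrite -(ler_pM2l L0); congr (_ <= _); field.
      by rewrite gt_eqF.
    apply: (le_trans (fdist_triangle gf mz Ts (Tu n) Tc)).
    rewrite [leRHS]splitr lerD//; last exact: ltW.
    by rewrite fdistC; exact: le_trans h1 h2.
  have norm_s e : 0 < e -> r2 / 2 - e <= `|s - c| /\ `|s - c| <= r2 + e.
    move=> e0; have [n [us _]] := lim e e0; have [h1 h2 _] := uP n.
    have g1 := ler_normD (c + u n - s) (s - c).
    have g2 := ler_normD (s - (c + u n)) (u n).
    have e1 : c + u n - s + (s - c) = u n by rewrite addrA subrK [c + _]addrC addrK.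
    have e2 : s - (c + u n) + u n = s - c by rewrite opprD addrA subrK.
    move: g1 g2; rewrite e1 e2 (distrC s (c + u n)).
    by split; lra.
  have sc1 : r2 / 2 <= `|s - c|.
    by apply/ler_addgt0Pr => e e0; have [] := norm_s e e0; lra.
  have sc2 : `|s - c| <= r2.
    by apply/ler_addgt0Pr => e e0; have [] := norm_s e e0.
  have := @fdist_gt0 (s - c) sc2.
  rewrite -normr_gt0 (lt_le_trans _ sc1) ?divr_gt0// => /(_ isT).
  by rewrite addrC subrK Dsc ltxx.
exists (k0 / r2); first by rewrite divr_gt0.
move=> tau taur; have [->|tau0] := eqVneq tau 0.
  by rewrite normr0 mulr0 fdist_ge0.
have nt : 0 < `|tau| by rewrite normr_gt0.
have lin n : n%:R * `|tau| <= r2 -> D (c + n%:R *: tau) c <= n%:R * D (c + tau) c.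
  elim: n => [|n IH] h; first by rewrite scale0r addr0 fdistxx mul0r.
  have hn : n%:R * `|tau| <= r2.
    by apply: le_trans h; rewrite ler_pM2r// ler_nat.
  have Tn : T (c + n%:R *: tau) by apply: Tt; rewrite normrZ ger0_norm.
  have Tn1 : T (c + n.+1%:R *: tau) by apply: Tt; rewrite normrZ ger0_norm.
  apply: (le_trans (fdist_triangle gf mz Tn1 Tn Tc)).
  rewrite -[in leRHS]natr1 mulrDl mul1r addrC lerD ?IH//.
  have := @fdist_translate _ _ _ _ _ _ _ gf mz hom (n%:R *: tau) (c + tau) c (Tt _ taur) Tc.
  have -> : c + tau + n%:R *: tau = c + n.+1%:R *: tau.
    by rewrite -natr1 scalerDl scale1r addrA addrAC.
  by move=> /(_ Tn1 Tn) ->.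
(* The largest [n] with [n%:R * |tau| <= r2]; as [n >= 1], rounding down loses at most a factor 2,
   so the multiple is in the shell. *)
pose n := Num.truncn (r2 / `|tau|).
have /andP[n1 n2] : n%:R <= r2 / `|tau| < n.+1%:R by apply: truncn_itv; rewrite divr_ge0 ?ltW.
have n0 : (1 <= n)%N.
  by rewrite lt0n; apply: contraTneq n2 => ->; rewrite -leNgt ler_pdivlMr// mul1r.
have hn : n%:R * `|tau| <= r2 by rewrite -ler_pdivlMr.
have n0R : 1 <= n%:R :> R by rewrite ler1n.
have hn2 : r2 / 2 <= n%:R * `|tau|.
  by move: n2; rewrite ltr_pdivrMr// -natr1; nra.
have := shell (n%:R *: tau); rewrite normrZ ger0_norm// => /(_ hn2 hn).
move=> /le_trans/(_ (lin n hn)) h.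
rewrite mulrAC ler_pdivrMr//.
apply: (@le_trans _ _ (n%:R * D (c + tau) c * `|tau|)); first by rewrite ler_pM2r.
by rewrite mulrAC mulrC ler_wpM2l// fdist_ge0.
Qed.

End nondegenerate.

(** * Excursion probabilities *)

(** Induction by inclusion-exclusion for two sets. The cruder count [(size s) ^+ 2] of pairs is
    enough below. *)
Lemma bonferroni_le (R : realType) (d : measure_display) (Y : measurableType d)
  (P : probability Y R) (I : eqType) (s : seq I) (F : I -> set Y) (p q : R) :
  uniq s -> 0 <= q -> (forall i, i \in s -> measurable (F i)) ->
  (forall i, i \in s -> (p%:E <= P (F i))%E) ->
  (forall i j, i \in s -> j \in s -> i != j -> (P (F i `&` F j) <= q%:E)%E) ->
  (((size s)%:R * p - (size s)%:R ^+ 2 * q)%:E <= P (\big[setU/set0]_(i <- s) F i))%E.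
Proof.
move=> us q0; elim: s us => [|i s IH] us mF Fp Fq.
  by rewrite big_nil measure0 mul0r expr0n/= mul0r subrr.
move: us => /= /andP[is_ us].
have sub j : j \in s -> j \in i :: s by rewrite in_cons orbC => ->.
have ms j : j \in s -> measurable (F j) by move=> /sub; exact: mF.
have mi : measurable (F i) by apply: mF; exact: mem_head.
have mU : measurable (\big[setU/set0]_(j <- s) F j).
  by rewrite big_seq; apply: bigsetU_measurable => j js; exact: ms.
have {}IH := IH us ms (fun j js => Fp j (sub j js))
  (fun j k js ks => Fq j k (sub j js) (sub k ks)).
have [mI PI] : measurable (\big[setU/set0]_(j <- s) (F i `&` F j)) /\
    (P (\big[setU/set0]_(j <- s) (F i `&` F j)) <= ((size s)%:R * q)%:E)%E.
  apply: measure_bigsetU_le => j js; first by apply: measurableI => //; exact: ms.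
  apply: Fq; rewrite ?mem_head ?sub//.
  by apply: contraNneq is_ => ->.
have IU : F i `&` \big[setU/set0]_(j <- s) F j = \big[setU/set0]_(j <- s) (F i `&` F j).
  by rewrite big_distrr.
have Pfin A : measurable A -> P A \is a fin_num by move=> mA; exact: fin_num_measure.
have UE : P (F i `|` \big[setU/set0]_(j <- s) F j) = (P (F i) +
    P (\big[setU/set0]_(j <- s) F j) - P (\big[setU/set0]_(j <- s) (F i `&` F j)))%E.
  rewrite -IU; apply: measureUfinl => //.
  by rewrite (le_lt_trans (probability_le1 _ _)) ?ltry.
rewrite big_cons UE; have := Fp i (mem_head _ _); move: IH PI.
rewrite -(fineK (Pfin _ mi)) -(fineK (Pfin _ mU)) -(fineK (Pfin _ mI)).
rewrite -EFinD -?EFinB !lee_fin /= -natr1 => h1 h2 h3.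
have n0 : 0 <= (size s)%:R :> R by [].
rewrite sqrrD expr1n mulr1; nra.
Qed.

Lemma powR_unbounded (R : realType) (a K : R) : 0 < a ->
  exists2 b0, 1 <= b0 & forall b, b0 <= b -> K <= b `^ a.
Proof.
move=> a0; pose K' := Num.max 1 K.
have K'0 : 0 < K' by rewrite lt_max ltr01.
exists (Num.max 1 (K' `^ a^-1)); first by rewrite le_max lexx.
move=> b; rewrite ge_max => /andP[b1 bK].
apply: (@le_trans _ _ K'); first by rewrite le_max lexx orbT.
rewrite -[leLHS](powRr1 (ltW K'0)) -(mulVf (lt0r_neq0 a0)) powRrM.
apply: ge0_ler_powR => //; rewrite ?nnegrE ?powR_ge0 ?ltW//.
by rewrite (lt_le_trans ltr01).
Qed.

Lemma exprn_mul_expRN_small (R : realType) (n : nat) (k beta A : R) :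
  0 < k -> 0 < beta -> 0 < A ->
  exists2 b0, 1 <= b0 & forall b, b0 <= b -> b ^+ n * expR (- (k * b `^ beta)) <= A.
Proof.
(* The term of degree [m.+1] of the exponential series dominates a multiple of [b ^+ n.+1]; the
   spare power of [b] makes the quotient small. *)
move=> k0 beta0 A0; pose m := Num.truncn (n.+1%:R / beta).
have nm : n.+1%:R <= beta * m.+1%:R.
  by have := truncnS_gt (n.+1%:R / beta); rewrite -/m ltr_pdivrMr// mulrC => /ltW.
pose Z := A * k ^+ m.+1 / (m.+1)`!%:R.
have Z0 : 0 < Z by rewrite divr_gt0 ?mulr_gt0 ?exprn_gt0// ltr0n fact_gt0.
exists (Num.max 1 Z^-1); first by rewrite le_max lexx.
move=> b; rewrite ge_max => /andP[b1 bZ].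
have b0 : 0 < b by rewrite (lt_le_trans ltr01).
have y0 : 0 <= k * b `^ beta by rewrite mulr_ge0 ?powR_ge0 ?ltW.
rewrite expRN ler_pdivrMr ?expR_gt0//.
have e1 : (k * b `^ beta) ^+ m.+1 / (m.+1)`!%:R <= expR (k * b `^ beta).
  by apply: le_trans (expR_ge1Dxn m y0); lra.
have e2 : b ^+ n.+1 <= (b `^ beta) ^+ m.+1.
  rewrite -(powR_mulrn n.+1 (ltW b0)) -(powR_mulrn m.+1 (powR_ge0 _ _)) -powRrM.
  exact: ler_powR.
apply: (@le_trans _ _ (Z * b ^+ n.+1)).
  rewrite exprS mulrA ler_peMl ?exprn_ge0 ?(ltW b0)//.
  by rewrite -[leLHS](divff (lt0r_neq0 Z0)) ler_pM2l.
apply: (@le_trans _ _ (A * ((k * b `^ beta) ^+ m.+1 / (m.+1)`!%:R))); last by rewrite ler_pM2l.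
rewrite /Z exprMn -!mulrA ler_pM2l// ler_pM2l ?exprn_gt0// mulrC ler_pM2r//.
Qed.

(** * Lower bound for the excursion probability over the whole set *)

Section excursion_lower_bound.
Context {R : realType} {dO : measure_display} {Omega : measurableType dO}.
Context {P : probability Omega R} {d : nat} {T : set 'rV[R]_d}.
Context {f : 'rV[R]_d -> {RV P >-> R}}.
Hypotheses (gf : gaussian_field T f) (mz : mean_zero T f) (hom : homogeneous T f).
Hypothesis (T0 : T 0).
Hypothesis var0 : (0 < 'V_P[f 0])%E.
Local Notation D := (fdist (f := f)).
Local Notation sigma := (fscale (f := f)).
Local Notation gauss := (@normal_prob R 0 1).

(** The common tail [p(b)] of the overview, expressed without reference to a point of [T]. *)
Definition exceed_prob (b : R) : R := fine (gauss `]b / sigma, +oo[%classic).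

Lemma exceed_probE (b : R) t : T t -> P [set w | b < f t w] = (exceed_prob b)%:E.
Proof.
move=> Tt; rewrite /exceed_prob.
rewrite (centered_normal_tail _ (fscale_gt0 gf mz hom T0 var0) (fscaleP gf mz hom T0 Tt)).
by rewrite fineK// fin_num_measure.
Qed.

Lemma sup_exceeds_ge (b : R) t : T t -> [set w | b < f t w] `<=` sup_exceeds f T b.
Proof.
move=> Tt w /= bw; rewrite /sup_exceeds/=.
by apply: (@lt_le_trans _ _ (f t w)%:E); [rewrite lte_fin|apply: ereal_sup_ubound; exists t].
Qed.

Variables (c : 'rV[R]_d) (r2 kappa : R).
Hypotheses (r20 : 0 < r2) (kappa0 : 0 < kappa).
Hypothesis cT : forall tau : 'rV[R]_d, `|tau| <= r2 -> T (c + tau).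
Hypothesis coercive : forall tau : 'rV[R]_d, `|tau| <= r2 -> kappa * `|tau| <= D (c + tau) c.

Lemma joint_exceed_le (s t : 'rV[R]_d) (h b : R) : T s -> T t -> 0 <= b -> 0 <= h ->
  h <= D s t -> h <= sigma ->
  (P ([set w | (b < f s w)%R] `&` [set w | (b < f t w)%R]) <=
   (expR (- (b ^+ 2 / (2 * sigma ^+ 2))) *
    expR (- (h ^+ 2 / (8 * sigma ^+ 4) * b ^+ 2)))%:E)%E.
Proof.
move=> Ts Tt b0 h0 hD hs.
have s0 : 0 < sigma := fscale_gt0 gf mz hom T0 var0.
(* The sum [f s + f t] exceeds [2 * b] and has variance at most [4 * sigma ^+ 2 * (1 - x)]; the
   extra factor comes from [(1 + x) * (1 - x) <= 1]. *)
pose x := h ^+ 2 / (4 * sigma ^+ 2).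
have x0 : 0 <= x.
  by apply: divr_ge0; [exact: sqr_ge0|apply: mulr_ge0 => //; exact: sqr_ge0].
have xE : h ^+ 2 = x * (4 * sigma ^+ 2) by rewrite /x; field; rewrite gt_eqF.
have x1 : x <= 4^-1.
  rewrite /x ler_pdivrMr ?mulr_gt0 ?exprn_gt0// mulrA mulVf// mul1r.
  by rewrite ler_sqr ?nnegrE//; exact: ltW.
have v0 : 0 < 4 * sigma ^+ 2 * (1 - x).
  by rewrite mulr_gt0 ?mulr_gt0 ?exprn_gt0//; lra.
have mE u : measurable [set w | b < f u w] by apply: measurable_exceed; exact: measurable_field.
apply: (@le_trans _ _ (P [set w | 2 * b < f s w + f t w])).
  apply: le_measure; rewrite ?inE//.
  - exact: measurableI.
  - by apply: measurable_exceed; apply: measurable_funD; exact: measurable_field.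
  - by move=> w [/= h1 h2]; lra.
apply: (le_trans (centered_normal_tail_le _ v0 _ (fsumP gf mz Ts Tt))).
- by rewrite mulr_ge0.
- rewrite (fsum_sqr gf mz hom T0 Ts Tt).
  have : h ^+ 2 <= D s t ^+ 2 by rewrite ler_sqr ?nnegrE ?fdist_ge0.
  by rewrite xE; lra.
rewrite lee_fin -expRD ler_expR -opprD lerN2.
have w0 : 0 < 2 * (4 * sigma ^+ 2 * (1 - x)) by apply: mulr_gt0.
rewrite ler_pdivlMr// xE.
rewrite [leLHS](_ : _ = (1 + x) * (1 - x) * 4 * b ^+ 2); last first.
  by field; rewrite gt_eqF.
rewrite exprMn ler_wpM2r ?sqr_ge0//.
have := sqr_ge0 x; lra.
Qed.

Lemma natr_dist_ge1 (m n : nat) : m != n -> 1 <= `|m%:R - n%:R : R|.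
Proof.
move=> mn; wlog lt : m n mn / (n < m)%N.
  move=> H; have [lt|lt|e] := ltngtP n m; first exact: H.
    by rewrite distrC; apply: H; rewrite // eq_sym.
  by rewrite e eqxx in mn.
by rewrite ger0_norm ?subr_ge0 ?ler_nat ?(ltnW lt)// lerBrDr nat1r ler_nat.
Qed.

Lemma sup_exceeds_lower_bound (alpha : R) : 0 < alpha < 1 ->
  exists2 A, 0 < A & exists2 b0, 1 <= b0 & forall b, b0 <= b ->
    0 < exceed_prob b /\
    ((A * b `^ (alpha * d%:R) * exceed_prob b)%:E <= (P^*)%mu (sup_exceeds f T b))%E.
Proof.
move=> /andP[al0 al1].
have s0 : 0 < sigma := fscale_gt0 gf mz hom T0 var0.
have Tc : T c by have := @cT 0; rewrite normr0 addr0; apply; exact: ltW.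
have [c0 c00 tail] := centered_normal_tail_ge P.
pose k := kappa ^+ 2 / (8 * sigma ^+ 4).
have k0 : 0 < k by rewrite divr_gt0 ?mulr_gt0 ?exprn_gt0.
pose beta := (1 - alpha) * 2.
have beta0 : 0 < beta by rewrite mulr_gt0 ?subr_gt0.
pose A' := c0 * sigma / (2 * r2 ^+ d).
have A'0 : 0 < A' by rewrite divr_gt0 ?mulr_gt0 ?exprn_gt0.
(* Beyond [b1] the pairs cost at most half of the main term, where the degree [d.+1] pays for the
   factor [b^-1] in the tail bound; beyond [b2] the grid has [n >= r2 * B / 2]; beyond [b3] the
   separation [kappa * h] is at most [sigma]. *)
have [b1 b11 small] := exprn_mul_expRN_small d.+1 k0 beta0 A'0.
have [b2 b21 big1] := powR_unbounded (2 / r2) al0.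
have [b3 b31 big2] := powR_unbounded (kappa / sigma) al0.
exists ((r2 / 2) ^+ d / 2); first by rewrite divr_gt0 ?exprn_gt0 ?divr_gt0.
exists (Num.max (Num.max b1 b2) (Num.max b3 sigma)); first by rewrite !le_max b11.
move=> b; rewrite !ge_max => /andP[/andP[bb1 bb2] /andP[bb3 bs]].
have b_ge1 : 1 <= b by exact: le_trans bb1.
have b_gt0 : 0 < b by exact: lt_le_trans b_ge1.
pose B := b `^ alpha.
have B0 : 0 < B by exact: powR_gt0.
have Bb : B <= b by rewrite /B -[leRHS](powRr1 (ltW b_gt0)); apply: ler_powR => //; exact: ltW.
pose h := B^-1.
have h0 : 0 < h by rewrite invr_gt0.
pose n := Num.truncn (r2 * B).
have /andP[n1 n2] : n%:R <= r2 * B < n.+1%:R by apply: truncn_itv; rewrite mulr_ge0 ?ltW.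
have n3 : r2 / 2 * B <= n%:R.
  have := big1 b bb2; rewrite ler_pdivrMr// -/B; rewrite -natr1 in n2; lra.
have nh : h * n%:R <= r2 by rewrite mulrC ler_pdivrMr.
pose vec (l : {ffun 'I_d -> 'I_n}) : 'rV[R]_d := h *: \row_i (l i)%:R.
have vec_le l : `|vec l| <= r2.
  apply/rV_norm_le => [|i]; first exact: ltW.
  rewrite !mxE normrM (gtr0_norm h0) normr_nat; apply: le_trans nh.
  by rewrite ler_pM2l// ler_nat ltnW.
have vecB_le l l' : `|vec l - vec l'| <= r2.
  apply/rV_norm_le => [|i]; first exact: ltW.
  rewrite !mxE -mulrBr normrM gtr0_norm//; apply: le_trans nh.
  rewrite ler_pM2l// ler_norml.
  have := ler_nat R (l i) n; have := ler_nat R (l' i) n; rewrite !(ltnW (ltn_ord _)).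
  by move=> /idP ? /idP ?; have := ler0n R (l i); have := ler0n R (l' i); lra.
have vecB_ge l l' : l != l' -> h <= `|vec l - vec l'|.
  move=> ll'; have [i li] : exists i, l i != l' i.
    apply: contrapT => no; move/negP: ll'; apply; apply/eqP/ffunP => i.
    by apply/eqP; apply: contrapT => /negP li; apply: no; exists i.
  apply: le_trans (rV_coord_le _ i).
  rewrite !mxE -mulrBr normrM gtr0_norm// ler_peMr ?(ltW h0)//.
  exact: natr_dist_ge1.
pose F l := [set w | b < f (c + vec l) w].
have mF l : measurable (F l) by apply: measurable_exceed; exact: measurable_field.
pose g := expR (- (b ^+ 2 / (2 * sigma ^+ 2))).
have g0 : 0 < g by exact: expR_gt0.
pose e := expR (- (k * b `^ beta)).
have pE := @exceed_probE b.
have p_ge : c0 * sigma / b * g <= exceed_prob b.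
  by have := tail _ _ _ s0 bs (fscaleP gf mz hom T0 Tc); rewrite pE.
have p0 : 0 < exceed_prob b.
  by apply: lt_le_trans p_ge; rewrite mulr_gt0 ?divr_gt0 ?mulr_gt0.
split=> //.
have pair l l' : l != l' -> (P (F l `&` F l') <= (g * e)%:E)%E.
  move=> ll'.
  have Dge : kappa * h <= D (c + vec l) (c + vec l').
    have := @fdist_translate _ _ _ _ _ _ _ gf mz hom (vec l')
      (c + (vec l - vec l')) c (cT (vecB_le l l')) Tc.
    rewrite -addrA subrK => /(_ (cT (vec_le l)) (cT (vec_le l'))) ->.
    apply: le_trans (coercive (vecB_le l l')).
    by rewrite ler_pM2l// vecB_ge.
  have hs : kappa * h <= sigma.
    rewrite ler_pdivrMr// mulrC -ler_pdivrMr//; exact: big2.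
  have kh0 : 0 <= kappa * h by rewrite mulr_ge0 ?ltW.
  apply: (le_trans (joint_exceed_le (cT (vec_le l)) (cT (vec_le l')) (ltW b_gt0) kh0 Dge hs)).
  rewrite lee_fin /g /e ler_pM2l ?expR_gt0// ler_expR lerN2.
  have -> : b `^ beta = (h * b) ^+ 2.
    rewrite /beta powRrM -[2]/(2%:R) powR_mulrn ?powR_ge0//; congr (_ ^+ 2).
    rewrite powRD; last by rewrite (gt_eqF b_gt0) implybT.
    by rewrite powRr1 ?ltW// powRN mulrC.
  by rewrite le_eqVlt; apply/orP; left; apply/eqP; rewrite /k; field; rewrite gt_eqF.
have bonf := @bonferroni_le _ _ _ P _ (enum {: {ffun 'I_d -> 'I_n}}) F (exceed_prob b) (g * e)
  (enum_uniq _) (mulr_ge0 (ltW g0) (expR_ge0 _)) (fun l _ => mF l) _ (fun l l' _ _ => pair l l').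
apply: (@le_trans _ _ (P (\big[setU/set0]_(l <- enum {: {ffun 'I_d -> 'I_n}}) F l))); last first.
  rewrite -measurable_mu_extE; last by apply: bigsetU_measurable => l _.
  apply: le_mu_ext => w; rewrite -bigcup_seq => -[l _ Flw].
  exact: (sup_exceeds_ge (cT (vec_le l)) Flw).
apply: le_trans (bonf _); last by move=> l _; rewrite /F (pE _ (cT (vec_le l))).
rewrite -cardE card_ffun !card_ord lee_fin natrX.
have nd_ge : (r2 / 2) ^+ d * b `^ (alpha * d%:R) <= n%:R ^+ d.
  rewrite powRrM powR_mulrn ?powR_ge0// -exprMn.
  by apply: lerXn2r; rewrite ?nnegrE// mulr_ge0 ?divr_ge0 ?powR_ge0 ?ltW.
have nd_le : n%:R ^+ d <= r2 ^+ d * b ^+ d.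
  rewrite -exprMn; apply: lerXn2r; rewrite ?nnegrE//; last first.
    by apply: (le_trans n1); rewrite ler_pM2l.
  by apply: mulr_ge0; exact: ltW.
(* Each grid point is charged for its [n ^ d] pairs, and this leaves at least half of its own
   probability. *)
have half : n%:R ^+ d * (g * e) <= exceed_prob b / 2.
  apply: (@le_trans _ _ (c0 * sigma / b * g / 2)); last by rewrite ler_pM2r.
  apply: (@le_trans _ _ (r2 ^+ d * b ^+ d * (g * e))).
    by rewrite ler_wpM2r// mulr_ge0 ?expR_ge0.
  have := small b bb1; rewrite -/e exprS /A' ler_pdivlMr ?mulr_gt0 ?exprn_gt0// => h1.
  rewrite -(ler_pM2r (_ : 0 < 2 * b)) ?mulr_gt0//.
  rewrite [leRHS](_ : _ = c0 * sigma * g); last by field; rewrite gt_eqF.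
  rewrite [leLHS](_ : _ = (b * b ^+ d * e * (2 * r2 ^+ d)) * g); last by ring.
  by rewrite ler_pM2r.
have nd0 : 0 <= n%:R ^+ d :> R by rewrite exprn_ge0.
have hm : n%:R ^+ d * (n%:R ^+ d * (g * e)) <= n%:R ^+ d * (exceed_prob b / 2) by rewrite ler_wpM2l.
apply: (@le_trans _ _ (n%:R ^+ d * exceed_prob b / 2)).
  rewrite [leLHS](_ : _ = (r2 / 2) ^+ d * b `^ (alpha * d%:R) * (exceed_prob b / 2)).
    by rewrite -[leRHS]mulrA ler_pM2r// divr_gt0.
  by move: (_ ^+ d) (_ `^ _) => ? ?; field.
rewrite expr2 -[X in _ - X]mulrA; lra.
Qed.

End excursion_lower_bound.

(** * Comparison of the union bound with the lower bound *)

Lemma sup_exceeds_fset (R : realType) (dO : measure_display) (Omega : measurableType dO)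
  (P : probability Omega R) (d : nat) (f : 'rV[R]_d -> {RV P >-> R})
  (S : {fset 'rV[R]_d}) (b : R) :
  sup_exceeds f [set` S] b `<=` \big[setU/set0]_(t <- S) [set w | b < f t w].
Proof.
move=> w /ereal_sup_gt[_ [t /= tS <-]]; rewrite lte_fin => bt.
by rewrite -bigcup_seq; exists t.
Qed.

(** The bound [y <= 1] makes the denominator finite, so that the quotient is one of real numbers. *)
Lemma outer_ratio_le (R : realType) (x y : \bar R) (X Y : R) :
  (0 <= x)%E -> (x <= X%:E)%E -> 0 < Y -> (Y%:E <= y)%E -> (y <= 1)%E ->
  (x / y <= (X / Y)%:E)%E.
Proof.
move=> x0 xX Y0 Yy y1.
have xE : x \is a fin_num by rewrite ge0_fin_numE// (le_lt_trans xX) ?ltry.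
have y0 : (0 <= y)%E by apply: le_trans Yy; rewrite lee_fin ltW.
have yE : y \is a fin_num by rewrite ge0_fin_numE// (le_lt_trans y1) ?ltry.
move: x0 xX Yy; rewrite -(fineK xE) -(fineK yE) !lee_fin => x0 xX Yy.
have y_gt0 := lt_le_trans Y0 Yy.
rewrite inver gt_eqF// -EFinM lee_fin; apply: ler_pM => //.
  by rewrite invr_ge0 ltW.
by rewrite lef_pV2.
Qed.

Lemma cond_prob_ge0 (R : realType) (dO : measure_display) (Omega : measurableType dO)
  (P : probability Omega R) (A B : set Omega) : (0 <= cond_prob P A B)%E.
Proof.
rewrite /cond_prob; apply: mule_ge0; first exact: mu_ext_ge0.
by rewrite inve_ge0; exact: mu_ext_ge0.
Qed.

Theorem theorem7p4 (R : realType) (dO : measure_display)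
    (Omega : measurableType dO) (P : probability Omega R)
    (d : nat) (T : set 'rV[R]_d) (f : 'rV[R]_d -> {RV P >-> R}) (theta : R) :
  (0 < d)%N ->
  compact T ->
  gaussian_field T f ->
  mean_zero T f ->
  (forall t, T t -> (0 < 'V_P[f t])%E) ->
  condition_B1 T f ->
  condition_B2 T ->
  unique_global_max T f ->
  0 < theta < 1 ->
  ereal_sup
    [set cond_prob P (sup_exceeds f [set` S] b) (sup_exceeds f T b)
      | S in [set S : {fset 'rV[R]_d} |
               [set` S] `<=` T /\ #|` S|%:R <= b `^ (theta * d%:R)]]
    @[b --> +oo] --> 0%E.
Proof.
move=> d0 compT gf mz varf [hom C2f] [T0 _ [c intc] _ _] uf /andP[th0 th1].
have var0 := varf 0 T0.
have /nbhs_ballP[r r_gt0 ballT] : nbhs c T by [].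
pose r1 := r / 2.
have r10 : 0 < r1 by rewrite divr_gt0.
have cT x : `|x - c| <= r1 -> T x.
  move=> xc; apply: ballT; rewrite mx_norm_ball /ball_/= distrC (le_lt_trans xc)//.
  by rewrite /r1 ltr_pdivrMr// ltr_pMr// ltr1n.
have [M TM] : exists M : nat, forall x, T x -> `|x| <= M%:R.
  have [K [_ HK]] := compact_bounded compT.
  by exists (Num.truncn K).+1 => x Tx; apply: HK => //; exact: truncnS_gt.
have cf : {ae P, forall w, continuous_on T (fun t => f t w)}.
  by apply: filterS C2f => w; exact: C2_set_continuous_on.
have [L [r0 [L0 r00 lip]]] := fdist_lipschitz gf mz hom C2f r10 cT.
have [kappa kappa0 coercive] :=
  fdist_coercive gf mz hom T0 var0 compT TM cf uf L0 r00 lip r10 cT.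
have r20 : 0 < r1 / 2 by rewrite divr_gt0.
have cT2 (tau : 'rV[R]_d) : `|tau| <= r1 / 2 -> T (c + tau).
  move=> h; apply: (centreD_in cT); apply: (le_trans h).
  by rewrite ler_pdivrMr// ler_peMr ?ler1n// ltW.
(* Any exponent strictly between [theta] and 1 would do. *)
pose alpha := (1 + theta) / 2.
have al01 : 0 < alpha < 1 by rewrite /alpha; apply/andP; split; lra.
have [A A0 [b0 b01 lower]] :=
  sup_exceeds_lower_bound gf mz hom T0 var0 r20 kappa0 cT2 coercive al01.
pose gam := (alpha - theta) * d%:R.
have gam0 : 0 < gam by rewrite mulr_gt0 ?ltr0n// /alpha; lra.
pose g b := (A^-1 * b `^ (- gam))%R.
(* The tail probability cancels in the quotient of the two bounds; what remains is [A^-1] times a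
   negative power of [b], uniformly in [S]. *)
have upper b (S : {fset 'rV[R]_d}) : b0 <= b -> [set` S] `<=` T ->
    #|` S|%:R <= b `^ (theta * d%:R) ->
    (cond_prob P (sup_exceeds f [set` S] b) (sup_exceeds f T b) <= (g b)%:E)%E.
  move=> bb0 ST Sb; have [p0 low] := lower b bb0.
  have b_gt0 : 0 < b by apply: lt_le_trans bb0; exact: lt_le_trans b01.
  have [mU PU] : measurable (\big[setU/set0]_(t <- S) [set w | b < f t w]) /\
      (P (\big[setU/set0]_(t <- S) [set w | (b < f t w)%R]) <=
        ((size S)%:R * exceed_prob (f := f) b)%:E)%E.
    apply: measure_bigsetU_le => t tS.
      by apply: measurable_exceed; exact: measurable_field.
    by rewrite -(exceed_probE gf mz hom T0 var0 b (ST _ tS)).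
  have num : ((P^*)%mu (sup_exceeds f [set` S] b `&` sup_exceeds f T b) <=
      (b `^ (theta * d%:R) * exceed_prob (f := f) b)%:E)%E.
    apply: (@le_trans _ _ ((P^*)%mu (\big[setU/set0]_(t <- S) [set w | b < f t w]))).
      by apply: le_mu_ext => w [+ _]; exact: sup_exceeds_fset.
    rewrite measurable_mu_extE//; apply: (le_trans PU).
    by rewrite lee_fin ler_pM2r.
  have den1 : ((P^*)%mu (sup_exceeds f T b) <= 1)%E.
    rewrite -(probability_setT P) -measurable_mu_extE//; exact: le_mu_ext.
  have Y0 : 0 < A * b `^ (alpha * d%:R) * exceed_prob (f := f) b.
    by rewrite !mulr_gt0 ?powR_gt0.
  have num0 : (0 <= (P^*)%mu (sup_exceeds f [set` S] b `&` sup_exceeds f T b))%E.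
    exact: mu_ext_ge0.
  apply: (le_trans (outer_ratio_le num0 num Y0 low den1)).
  rewrite lee_fin /g /gam mulrBl opprB powRD; last by rewrite (gt_eqF b_gt0) implybT.
  rewrite powRN le_eqVlt; apply/orP; left; apply/eqP; field.
  by rewrite !gt_eqF ?powR_gt0.
apply: (@squeeze_cvge _ _ _ _ (fun=> 0%E) _ (fun b => (g b)%:E)).
- apply: filterS (nbhs_pinfty_ge (num_real b0)) => b bb0; apply/andP; split.
    (* The supremum is nonnegative because the empty set is an admissible [S]. *)
    apply: (@le_trans _ _ (cond_prob P (sup_exceeds f [set` fset0] b) (sup_exceeds f T b))).
      exact: cond_prob_ge0.
    apply: ereal_sup_ubound; exists fset0 => //; split; last by rewrite cardfs0 powR_ge0.
    by move=> x /=; rewrite inE.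
  by apply: ge_ereal_sup => _ [S [ST Sb] <-]; exact: upper.
- exact: cvg_cst.
apply: cvg_EFin; first exact: nearW.
apply/cvgr0Pnorm_le => e e0.
have [b1 b11 big] := powR_unbounded (A^-1 / e) gam0.
apply: filterS (nbhs_pinfty_ge (num_real b1)) => b bb1 /=.
have b_gt0 : 0 < b by apply: lt_le_trans bb1; exact: lt_le_trans b11.
rewrite /g ger0_norm ?mulr_ge0 ?powR_ge0 ?invr_ge0 ?(ltW A0)//.
by rewrite powRN ler_pdivrMr ?powR_gt0// mulrC -ler_pdivrMr//; exact: big.
Qed.
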